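(* Let $n\ge2$ and let $B$ be a homothecy invariant convex density basis in $\mathbb{R}^n$. Then the following statements are equivalent: (1) $B$ differentiates the class $L(\mathbb{R}^n)$; (2) $B$ is a regular basis; (3) there exist positive constants $c_1,c_2$ such that the halo function of $B$ satisfies $c_1t\le\varphi_B(t)\le c_2t$ for all $t\ge1$.
   Context: $L(\mathbb{R}^n)$ is the class of Lebesgue integrable functions on $\mathbb{R}^n$; $|E|$ is Lebesgue measure. A differentiation basis (basis) $B$ in $\mathbb{R}^n$ is a mapping assigning to each $x\in\mathbb{R}^n$ a family $B(x)$ of bounded measurable sets of positive measure containing $x$, such that there is a sequence $(R_k)$ in $B(x)$ with $\operatorname{diam}R_k\to 0$. For $f\in L(\mathbb{R}^n)$, $\overline{D}_B(\int f,x)$ and $\underline{D}_B(\int f,x)$ denote the upper and lower limits of $\frac{1}{|R|}\int_R f$ over $R\in B(x)$ as $\operatorname{diam}R\to 0$. $B$ differentiates $\int f$ if $\overline{D}_B(\int f,x)=\underline{D}_B(\int f,x)=f(x)$ for almost all $x$; $B$ differentiates a class $F\subset L(\mathbb{R}^n)$ if it differentiates $\int f$ for every $f\in F$. $B$ is homothecy invariant if $R\in B(x)$ implies $H(R)\in B(H(x))$ for every homothecy $H$ of $\mathbb{R}^n$ (maps $x\mapsto a+t(x-a)$ with $a\in\mathbb{R}^n$, $t>0$; a homothecy invariant basis is then also translation invariant); convex if all sets in all $B(x)$ are convex; a density basis if $B$ differentiates $\int\chi_E$ for every bounded measurable set $E\subset\mathbb{R}^n$. $B$ is regular if there is $c\ge1$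 such that for every set $R\in\bigcup_{x}B(x)$ there is a cubic interval $Q$ (a cube with sides parallel to the axes) with $R\subset Q$ and $|Q|\le c|R|$. The maximal operator is $M_B(f)(x)=\sup_{R\in B(x)}\frac1{|R|}\int_R|f|$. The halo function of a homothecy invariant density basis $B$ is $\varphi_B(t)=1$ for $0\le t\le1$ and $\varphi_B(t)=\sup_E\frac{|\{M_B(\chi_E)\ge1/t\}|}{|E|}$ for $t>1$, the supremum being over all bounded measurable sets $E$ of positive measure. *)

(* Defs.v *)
From HB Require Import structures.
From mathcomp Require Import all_boot all_order all_algebra.
From mathcomp Require Import all_classical all_reals all_analysis.

Set Implicit Arguments.
Unset Strict Implicit.
Unset Printing Implicit Defensive.

Import Order.TTheory GRing.Theory Num.Theory.
Import numFieldNormedType.Exports.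

Local Open Scope classical_set_scope.
Local Open Scope ring_scope.
Local Open Scope ereal_scope.

Section lebesgue_outer_measure.
Variables (R : realType) (n : nat).
Local Notation V := 'rV[R]_n.

(* A box is either [None], the empty set, or a product of intervals
   ]a_i, b_i]. The constructor [None] is there so that the empty set can be
   covered at no cost also when n = 0, where a product of intervals is a
   point, of volume 1. *)
Definition box_set (c : option (V * V)) : set V :=
  if c is Some (a, b) then
    [set x | forall i, (a ord0 i < x ord0 i <= b ord0 i)%R]
  else set0.

Definition box_vol (c : option (V * V)) : R :=
  if c is Some (a, b) then
    (\prod_(i < n) Num.max 0 (b ord0 i - a ord0 i))%R
  else 0%R.

Definition box_cover (X : set V) : set (nat -> option (V * V)) :=
  [set c | X `<=` \bigcup_k box_set (c k)].

Definition lebesgue_outer (X : set V) : \bar R :=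
  ereal_inf [set \sum_(k <oo) (box_vol (c k))%:E | c in box_cover X].

Lemma box_vol_ge0 c : 0 <= (box_vol c)%:E.
Proof.
rewrite lee_fin; case: c => [[a b]|]//=.
by apply: prodr_ge0 => i _; rewrite le_max lexx.
Qed.

Lemma lebesgue_outer_ge0 X : 0 <= lebesgue_outer X.
Proof.
apply: le_ereal_inf_tmp => _ [c _ <-].
by apply: nneseries_ge0 => k _ _; exact: box_vol_ge0.
Qed.

Lemma lebesgue_outer0 : lebesgue_outer set0 = 0.
Proof.
apply/eqP; rewrite eq_le lebesgue_outer_ge0 andbT.
apply: ereal_inf_lbound; exists (fun=> None); first exact: sub0set.
by rewrite eseries0.
Qed.

Lemma le_lebesgue_outer :
  {homo lebesgue_outer : X Y / X `<=` Y >-> X <= Y}.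
Proof.
move=> X Y XY; apply/ereal_inf_le_tmp => _ [c Yc <-].
by exists c => //; exact: subset_trans Yc.
Qed.

Lemma lebesgue_outer_sigma_subadditive : sigma_subadditive lebesgue_outer.
Proof.
move=> A; have [[i ioo]|] := pselect (exists i, lebesgue_outer (A i) = +oo).
  rewrite (eseries_pinfty _ _ ioo) ?leey// => k _.
  by rewrite -ltNye (lt_le_trans _ (lebesgue_outer_ge0 _)).
rewrite -forallNE => Aoo.
apply/lee_addgt0Pr => _/posnumP[e].
rewrite (le_trans _ (epsilon_trick _ _ _))//; last first.
  by move=> k; exact: lebesgue_outer_ge0.
pose P k (c : nat -> option (V * V)) := box_cover (A k) c /\
  \sum_(j <oo) (box_vol (c j))%:E <=
    lebesgue_outer (A k) + (e%:num / (2 ^ k.+1)%:R)%:E.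
have [G PG] : {G : nat -> nat -> option (V * V) & forall k, P k (G k)}.
  apply: (@choice _ _ P) => k.
  have en1 : (0 < e%:num / (2 ^ k.+1)%:R)%R by [].
  have /(lb_ereal_inf_adherent en1)[_ [c Ac <-] lt_c] :
      lebesgue_outer (A k) \is a fin_num.
    rewrite ge0_fin_numE ?lebesgue_outer_ge0//.
    by rewrite ltey; apply/eqP; exact: Aoo.
  by exists c; split => //; exact/ltW.
pose v (p : nat * nat) := (box_vol (G p.1 p.2))%:E.
have v_ge0 p : 0 <= v p by exact: box_vol_ge0.
apply: (@le_trans _ _ (\esum_(p in [set: nat * nat]) v p)).
  apply: ereal_inf_lbound => /=.
  have /card_esym/ppcard_eqP[f] := card_nat2.
  exists (fun k => G (f k).1 (f k).2).
    move=> t [i _ Ait]; have [j _ Gt] := (PG i).1 _ Ait.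
    by exists (f^-1%FUN (i, j)) => //=; rewrite invK ?inE.
  rewrite -(esum_pred_image v _ xpredT) ?[fun=> _]set_true//.
  by rewrite image_eq.
rewrite (_ : esum _ _ = \sum_(i <oo) \sum_(j <oo) v (i, j)); last first.
  pose J : nat -> set (nat * nat) := fun i => [set (i, j) | j in setT].
  rewrite (_ : setT = \bigcup_k J k); last first.
    by rewrite predeqE => -[a b]; split => // _; exists a => //; exists b.
  rewrite esum_bigcupT /=; last 2 first.
  - apply/trivIsetP => i j _ _ ij.
    rewrite predeqE => -[k m] /=; split => //= -[] [_] _ [<-{k} _].
    by move=> [m' _] [] /esym/eqP; rewrite (negbTE ij).
  - by [].
  rewrite -(image_id [set: nat]) -fun_true esum_pred_image//; last first.
    by move=> k _; exact: esum_ge0.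
  apply: eq_eseriesr => /= j _.
  rewrite -(esum_pred_image v (pair j) predT)//=; last first.
    by move=> ? ? _ _; exact: (@can_inj _ _ _ snd).
  by congr esum; rewrite predeqE => -[a b]; split; move=> [i _ <-]; exists i.
apply: lee_nneseries => [i _ _|i _]; last exact: (PG i).2.
by apply: nneseries_ge0 => j _ _; exact: v_ge0.
Qed.

HB.instance Definition _ := isOuterMeasure.Build R V lebesgue_outer
  lebesgue_outer0 lebesgue_outer_ge0 le_lebesgue_outer
  lebesgue_outer_sigma_subadditive.

End lebesgue_outer_measure.

(* R^n with the sigma-algebra of Lebesgue measurable sets, and the Lebesgue
   measure on it. *)
Notation lebesgue_space R n := (caratheodory_type (@lebesgue_outer R n)).

Definition leb (R : realType) (n : nat) : set (lebesgue_space R n) -> \bar R :=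
  @lebesgue_outer R n.
HB.instance Definition _ (R : realType) (n : nat) :=
  isMeasure.Build _ _ R (@leb R n)
    (@caratheodory_measure0 R _ (@lebesgue_outer R n))
    (@caratheodory_measure_ge0 R _ (@lebesgue_outer R n))
    (@caratheodory_measure_sigma_additive R _ (@lebesgue_outer R n)).

Section differentiation_bases.
Variables (R : realType) (n : nat).
Local Notation V := 'rV[R]_n.
Implicit Types (B : V -> set (set V)) (f : V -> R).

Definition lmeasurable (E : set V) : Prop :=
  measurable (E : set (lebesgue_space R n)).

Definition bounded_lmeasurable (E : set V) : Prop :=
  bounded_set E /\ lmeasurable E.

(* The norm of the library on 'rV[R]_n is the sup norm; diameters are
   Euclidean. *)
Definition eucl_dist (x y : V) : R :=
  Num.sqrt (\sum_(i < n) (x ord0 i - y ord0 i) ^+ 2)%R.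

Definition eucl_diam (A : set V) : \bar R :=
  ereal_sup [set (eucl_dist x y)%:E | x in A & y in A].

Definition is_basis B : Prop := forall x : V,
  (forall Q, B x Q -> [/\ bounded_lmeasurable Q, 0 < leb Q & Q x]) /\
  exists Q_ : nat -> set V,
    (forall k, B x (Q_ k)) /\ eucl_diam (Q_ k) @[k --> \oo] --> 0.

Definition average f (Q : set V) : \bar R :=
  (\int[@leb R n]_(y in Q) (f y)%:E) / leb Q.

Definition upper_derivative B f (x : V) : \bar R :=
  ereal_inf [set ereal_sup
    [set average f Q | Q in [set Q | B x Q /\ eucl_diam Q < d%:E]]
    | d in [set d : R | (0 < d)%R]].

Definition lower_derivative B f (x : V) : \bar R :=
  ereal_sup [set ereal_inf
    [set average f Q | Q in [set Q | B x Q /\ eucl_diam Q < d%:E]]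
    | d in [set d : R | (0 < d)%R]].

Definition lebesgue_integrable f : Prop :=
  (@leb R n).-integrable setT (fun y => (f y)%:E).

Definition differentiates B f : Prop :=
  {ae @leb R n, forall x,
    upper_derivative B f x = (f x)%:E /\ lower_derivative B f x = (f x)%:E}.

Definition differentiates_class B (F : set (V -> R)) : Prop :=
  forall f, F f -> differentiates B f.

Definition homothecy (a : V) (t : R) (x : V) : V := (a + t *: (x - a))%R.

Definition homothecy_invariant B : Prop :=
  forall (a : V) (t : R), (0 < t)%R -> forall x Q,
    B x Q -> B (homothecy a t x) (homothecy a t @` Q).

Definition convex_basis B : Prop :=
  forall x Q, B x Q -> convex_set (Q : set (convex_lmodType V)).

Definition density_basis B : Prop :=
  forall E, bounded_lmeasurable E -> differentiates B (\1_E).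

Definition cube (a : V) (s : R) : set V :=
  [set y | forall i, (a ord0 i <= y ord0 i <= a ord0 i + s)%R].

Definition regular_basis B : Prop :=
  exists2 c : R, (1 <= c)%R & forall x Q, B x Q ->
    exists (a : V) (s : R),
      [/\ (0 < s)%R, Q `<=` cube a s & leb (cube a s) <= c%:E * leb Q].

Definition maximal_operator B f (x : V) : \bar R :=
  ereal_sup [set average (fun y => `|f y|%R) Q | Q in B x].

(* Only the values at t >= 0 are meaningful. *)
Definition halo B (t : R) : \bar R :=
  if (t <= 1)%R then 1 else
  ereal_sup
    [set leb [set x | (t^-1)%:E <= maximal_operator B (\1_E) x] / leb E
     | E in [set E | bounded_lmeasurable E /\ 0 < leb E]].

End differentiation_bases.

(* Main.v *)
Require Import Defs.
From mathcomp Require Import all_boot all_order all_algebra.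
From mathcomp Require Import all_classical all_reals all_analysis.
From mathcomp Require Import measurable_realfun.
From mathcomp Require Import ring lra zify.

(** Only translation invariance, the scaling law and positivity of the measure
    matter, so the volume [kappa] of the unit cube is never computed.

    (2) => (1), (3). In a regular basis every set lies in a comparable cube, so
    the Vitali covering argument gives a weak type (1,1) inequality for the
    maximal operator. This is the upper bound on the halo function, and it makes
    the class of differentiated functions closed in L^1; that class contains the
    bounded sets because B is a density basis, hence the simple functions. The
    lower bound on the halo function needs no regularity: a unit cube is covered
    by the sets x + s R_0 for x in a cube of side comparable to s.

    (1) => (2), (3) => (2). If B is not regular, B(0) contains convex sets of
    measure 1 of arbitrarily large diameter. A convex set of measure 1 and large
    diameter meets a fixed bounded set in small measure, so m of these sets,
    chosen one after the other, have a union of measure of order m. After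
    erosion and reflection this says: for a small cube E, the points x such that
    some set of B(x) of measure 1 contains E fill a set of measure of order m.
    Hence the halo function exceeds m t up to a constant factor at t = 1 / |E|.
    Rescaled copies of E, placed by a greedy choice of grid translations, then
    give functions of small integral whose means over small sets are large on
    half of the unit cube; a sum of such functions is not differentiated. *)

Set Implicit Arguments.
Unset Strict Implicit.
Unset Printing Implicit Defensive.

Import Order.TTheory GRing.Theory Num.Theory.
Import numFieldNormedType.Exports HBSimple.

Local Open Scope classical_set_scope.
Local Open Scope ring_scope.
Local Open Scope ereal_scope.

(** * Affine images of boxes and of measurable sets *)

Section affine_maps.
Variables (R : realType) (n : nat).
Local Notation V := 'rV[R]_n.
Implicit Types (v x : V) (t r : R) (X A : set V).

(** Homothecies and translations in one family, closed under composition: a homothecy of ratio 1 is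
    only the identity, so homothecies alone would not do. *)
Definition aff v t x : V := (v + t *: x)%R.

Lemma affE v t x i : aff v t x ord0 i = (v ord0 i + t * x ord0 i)%R.
Proof. by rewrite !mxE. Qed.

Lemma aff_comp v t w r x : aff v t (aff w r x) = aff (v + t *: w) (t * r) x.
Proof. by rewrite /aff scalerDr scalerA addrA. Qed.

Lemma aff01 x : aff 0 1 x = x.
Proof. by rewrite /aff add0r scale1r. Qed.

Lemma aff_comp_image v t w r X :
  aff v t @` (aff w r @` X) = aff (v + t *: w) (t * r) @` X.
Proof.
rewrite image_comp; congr image; apply/funext => x; exact: aff_comp.
Qed.

(** The translation part of the inverse of [aff v t], whose ratio is [t^-1]. *)
Definition affV v t : V := (- (t^-1 *: v))%R.

Lemma affK v t : (0 < t)%R -> cancel (aff v t) (aff (affV v t) t^-1).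
Proof.
move=> t0 x; rewrite aff_comp /affV addNr mulVf ?gt_eqF//.
exact: aff01.
Qed.

Lemma affVK v t : (0 < t)%R -> cancel (aff (affV v t) t^-1) (aff v t).
Proof.
move=> t0 x; rewrite aff_comp /affV scalerN scalerA mulfV ?gt_eqF// scale1r.
rewrite subrr; exact: aff01.
Qed.

Lemma aff_inj v t : (0 < t)%R -> injective (aff v t).
Proof. by move=> t0; exact: can_inj (affK v t0). Qed.

Lemma aff_image_affV v t X : (0 < t)%R -> aff v t @` (aff (affV v t) t^-1 @` X) = X.
Proof.
move=> t0; rewrite image_comp (_ : _ \o _ = id) ?image_id//.
by apply/funext => x; exact: affVK.
Qed.

Lemma homothecyE (a : V) t : homothecy a t = aff ((1 - t) *: a) t.
Proof.
apply/funext => x; rewrite /homothecy /aff scalerBl scale1r scalerBr.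
by rewrite addrA addrAC.
Qed.

Lemma aff_box v t (c : option (V * V)) : (0 < t)%R ->
  aff v t @` box_set c = box_set (omap (fun ab => (aff v t ab.1, aff v t ab.2)) c).
Proof.
move=> t0; case: c => [[a b]|] /=; last by rewrite image_set0.
apply/seteqP; split => [_ [x /= xab <-] i|y /= yab].
  by rewrite !affE !lerD2l !ltrD2l !ler_pM2l ?ltr_pM2l//.
exists (aff (affV v t) t^-1 y); last exact: affVK.
move=> i; have := yab i; rewrite -{1 2}(affVK v t0 y) !affE.
by rewrite !lerD2l !ltrD2l !ler_pM2l ?ltr_pM2l//.
Qed.

Lemma box_vol_aff v t (c : option (V * V)) : (0 < t)%R ->
  box_vol (omap (fun ab => (aff v t ab.1, aff v t ab.2)) c) = (t ^+ n * box_vol c)%R.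
Proof.
move=> t0; case: c => [[a b]|] /=; last by rewrite mulr0.
have -> : (t ^+ n = \prod_(i < n) t)%R by rewrite prodr_const card_ord.
rewrite -big_split /=; apply: eq_bigr => i _.
rewrite !affE opprD addrACA subrr add0r -mulrBr.
by rewrite maxr_pMr ?mulr0// ltW.
Qed.

Lemma le_leb X A : X `<=` A -> leb X <= leb A.
Proof. exact: le_lebesgue_outer. Qed.

Lemma leb_ge0 X : 0 <= leb X.
Proof. exact: lebesgue_outer_ge0. Qed.

(** Box covers are carried to box covers, each volume being multiplied by [t ^+ n]; as this concerns
    the outer measure, [X] may be any set. The converse in [leb_aff] is this bound for the inverse
    map. *)
Lemma leb_aff_le v t X : (0 < t)%R -> leb (aff v t @` X) <= (t ^+ n)%:E * leb X.
Proof.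
move=> t0; have tn0 : (0 < t ^+ n)%R by rewrite exprn_gt0.
rewrite muleC -lee_pdivrMr//; apply: le_ereal_inf_tmp => _ [c cX <-].
rewrite lee_pdivrMr// muleC -nneseriesZl; last by move=> k _; exact: box_vol_ge0.
apply: ereal_inf_lbound.
exists (fun k => omap (fun ab => (aff v t ab.1, aff v t ab.2)) (c k)).
  move=> _ [x /cX[k _ cx] <-]; exists k => //.
  by rewrite -aff_box//; exists x.
by apply: eq_eseriesr => k _; rewrite box_vol_aff// EFinM.
Qed.

Lemma leb_aff v t X : (0 < t)%R -> leb (aff v t @` X) = (t ^+ n)%:E * leb X.
Proof.
move=> t0; apply/eqP; rewrite eq_le leb_aff_le//=.
have tn0 : (0 < t ^+ n)%R by rewrite exprn_gt0.
rewrite muleC -lee_pdivlMr// muleC.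
have := @leb_aff_le (affV v t) t^-1 (aff v t @` X).
rewrite invr_gt0 exprVn => /(_ t0); apply: le_trans.
by apply: le_leb => x Xx; exists (aff v t x); [exists x|exact: affK].
Qed.

(** Measurability is Caratheodory's splitting condition, by conversion. *)
Lemma lmeasurableE X : lmeasurable X =
  forall Y : set V, leb Y = leb (Y `&` X) + leb (Y `&` ~` X).
Proof. by []. Qed.

(** The test set is pulled back by the inverse map, and both sides of the splitting condition scale
    by the same factor. *)
Lemma lmeasurable_aff v t X : (0 < t)%R -> lmeasurable X -> lmeasurable (aff v t @` X).
Proof.
rewrite !lmeasurableE => t0 mX Y.
set g := aff (affV v t) t^-1.
have E1 : Y `&` aff v t @` X = aff v t @` (g @` Y `&` X).
  apply/seteqP; split => [z [Yz [x Xx xz]]|_ [x [[y Yy <-] Xx] <-]].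
    rewrite -xz in Yz *; exists x => //; split => //; by exists (aff v t x) => //; exact: affK.
  by split; [rewrite affVK|exists (g y)].
have E2 : Y `&` ~` (aff v t @` X) = aff v t @` (g @` Y `&` ~` X).
  apply/seteqP; split => [y [Yy nXy]|_ [x [[y Yy <-] Xx] <-]].
    exists (g y); last exact: affVK.
    split; first by exists y.
    by move=> Xgy; apply: nXy; exists (g y) => //; exact: affVK.
  split; first by rewrite affVK.
  by move=> [z Xz /aff_inj] => /(_ t0) zy; apply: Xx; rewrite -zy.
have -> : leb Y = (t ^+ n)%:E * leb (g @` Y).
  by rewrite -(leb_aff v)// aff_image_affV.
rewrite E1 E2 (mX (g @` Y)) (leb_aff v (g @` Y `&` X))//.
rewrite (leb_aff v (g @` Y `&` ~` X))// muleDr//.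
by apply: ge0_adde_def; rewrite inE; exact: leb_ge0.
Qed.

End affine_maps.

(** * Measure and measurability of boxes, cubes and bounded sets *)

Section boxes.
Variables (R : realType) (n : nat).
Local Notation V := 'rV[R]_n.
Implicit Types (a b v x : V) (s t r : R) (X A : set V).

Lemma leb_box_le (c : option (V * V)) : leb (box_set c) <= (box_vol c)%:E.
Proof.
apply: ereal_inf_lbound; exists (fun k => if k == 0%N then c else None).
  by move=> x cx; exists 0%N.
rewrite (@nneseriesD1 _ _ 0%N)//=; last by move=> k _; exact: box_vol_ge0.
by rewrite eseries0 ?adde0// => k _ /negbTE ->.
Qed.

(** The hyperplane cuts every box of a cover of [X] into two boxes, [lo] and [hi], of no larger
    total volume; they cover the two pieces of [X]. *)
Lemma lmeasurable_halfspace i (c : R) : lmeasurable [set x : V | (x ord0 i <= c)%R].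
Proof.
rewrite lmeasurableE; apply: (@le_caratheodory_measurable R V (@lebesgue_outer R n)).
move=> X; apply: le_ereal_inf_tmp => _ [k Xk <-].
pose lo (ab : V * V) := (ab.1,
  (\row_j if j == i then Num.min (ab.2 ord0 j) c else ab.2 ord0 j)%R : V).
pose hi (ab : V * V) :=
  ((\row_j if j == i then Num.max (ab.1 ord0 j) c else ab.1 ord0 j)%R : V, ab.2).
apply: (@le_trans _ _ (\sum_(j <oo) (box_vol (omap lo (k j)))%:E +
    \sum_(j <oo) (box_vol (omap hi (k j)))%:E)).
  apply: leeD; apply: ereal_inf_lbound.
    exists (fun j => omap lo (k j)) => // x [/Xk[j _ kx] xc]; exists j => //.
    move: kx; case: (k j) => [[a b]|]//= kx l; rewrite mxE.
    case/andP: (kx l) => -> /=; case: eqP => [-> xb|//].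
    by rewrite le_min xb.
  exists (fun j => omap hi (k j)) => // x [/Xk[j _ kx] xc]; exists j => //.
  move: kx; case: (k j) => [[a b]|]//= kx l; rewrite mxE.
  case/andP: (kx l) => + ->; rewrite andbT; case: eqP => [-> xb|//].
  by rewrite comparable_gt_max ?real_comparable ?num_real// xb ltNge; exact/negP.
rewrite -nneseriesD; [|by move=> *; exact: box_vol_ge0..].
apply: lee_nneseries => [j _ _|j _].
  by rewrite adde_ge0//; exact: box_vol_ge0.
case: (k j) => [[a b]|] /=; last by rewrite adde0.
have D (f : 'I_n -> R) : (\prod_l f l = f i * \prod_(l | l != i) f l)%R.
  by rewrite (bigD1 i).
rewrite -EFinD lee_fin !D !mxE eqxx.
under [X in (_ * X + _)%R]eq_bigr => l li do rewrite mxE (negbTE li).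
under [X in (_ + _ * X)%R]eq_bigr => l li do rewrite mxE (negbTE li).
rewrite -mulrDl; apply: ler_wpM2r.
  by apply: prodr_ge0 => l _; rewrite le_max lexx.
move: (a ord0 i) (b ord0 i) => p q.
rewrite /Num.max /Num.min; do ![case: ifPn; rewrite -?leNgt => ?]; lra.
Qed.

Lemma lmeasurable_box (c : option (V * V)) : lmeasurable (box_set c).
Proof.
case: c => [[a b]|]; last exact: measurable0.
have -> : box_set (Some (a, b)) = \bigcap_(i in [set: 'I_n])
    ([set x : V | (x ord0 i <= b ord0 i)%R] `\` [set x : V | (x ord0 i <= a ord0 i)%R]).
  apply/seteqP; split => [x /= xab i _|x /= xab i].
    by case/andP: (xab i) => ax xb; split => //=; apply/negP; rewrite -ltNge.
  by have [/= -> /negP] := xab i I; rewrite -ltNge => ->.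
apply: (@fin_bigcap_measurable _ (lebesgue_space R n)) => // i _.
by apply: (@measurableD _ (lebesgue_space R n)); exact: lmeasurable_halfspace.
Qed.

(** Half-open, unlike [cube]: it is then one of the boxes of the outer measure, and its grid
    translates are a tiling. *)
Definition hcube a s : set V :=
  [set y | forall i, (a ord0 i < y ord0 i <= a ord0 i + s)%R].

Lemma hcubeE a s : hcube a s = box_set (Some (a, a + const_mx s)%R).
Proof.
by apply/seteqP; split=> y /= h i; have := h i; rewrite !mxE.
Qed.

Lemma lmeasurable_hcube a s : lmeasurable (hcube a s).
Proof. by rewrite hcubeE; exact: lmeasurable_box. Qed.

Lemma aff_hcube v t a s : (0 < t)%R -> aff v t @` hcube a s = hcube (aff v t a) (t * s).
Proof.
move=> t0; rewrite !hcubeE aff_box//=; congr (box_set (Some (_, _))).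
by apply/rowP => i; rewrite !mxE mulrDr addrA.
Qed.

Lemma hcube_aff a s : (0 < s)%R -> hcube a s = aff a s @` hcube 0 1.
Proof. by move=> s0; rewrite aff_hcube// mulr1 /aff scaler0 addr0. Qed.

Lemma aff_cube v t a s : (0 < t)%R -> aff v t @` cube a s = cube (aff v t a) (t * s).
Proof.
move=> t0; apply/seteqP; split => [_ [x /= xab <-] i|y /= yab].
  by rewrite !affE -addrA -mulrDr !lerD2l !ler_pM2l.
exists (aff (affV v t) t^-1 y); last exact: affVK.
move=> i; have := yab i; rewrite -{1 2}(affVK v t0 y) !affE.
by rewrite -addrA -mulrDr !lerD2l !ler_pM2l.
Qed.

(* The volume of the unit cube; that it is positive follows from the existence
   of a basis ([kappa_gt0]). *)
Definition kappa : R := fine (leb (hcube 0 1)).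

Lemma leb_hcube a s : (0 < s)%R -> leb (hcube a s) = (s ^+ n * kappa)%:E.
Proof.
move=> s0; rewrite hcube_aff// leb_aff// EFinM; congr (_ * _).
rewrite fineK// ge0_fin_numE ?leb_ge0//.
by rewrite hcubeE; apply: le_lt_trans (leb_box_le _) _; rewrite ltry.
Qed.

Definition inbox r : set V := [set y | forall i, (`|y ord0 i| <= r)%R].

Lemma ler_coord (x : V) i : (`|x ord0 i| <= `|x|)%R.
Proof.
rewrite [leRHS]/Num.norm /= mx_normrE.
by apply/bigmax_geP; right => /=; exists (ord0, i).
Qed.

Lemma norm_inbox r (x : V) : (0 <= r)%R -> inbox r x -> (`|x| <= r)%R.
Proof.
move=> r0 xr; rewrite [leLHS]/Num.norm /= mx_normrE.
by apply/bigmax_leP; split => // -[i j] _ /=; rewrite ord1.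
Qed.

Lemma inbox_bounded r X : X `<=` inbox r -> bounded_set X.
Proof.
move=> Xr; exists (`|r|)%R; split; first exact: normr_real.
move=> M rM x /Xr xr; apply: norm_inbox; first exact: le_trans (ltW rM).
by move=> i; apply: le_trans (xr i) _; apply: le_trans (ltW rM); exact: ler_norm.
Qed.

Lemma bounded_inbox X : bounded_set X -> exists2 r, (0 < r)%R & X `<=` inbox r.
Proof.
move=> [M [_ XM]]; exists (`|M| + 1)%R => [|x Xx i]; first by rewrite ltr_pwDr.
apply: le_trans (ler_coord x i) _; apply: XM => //.
by apply: le_lt_trans (ler_norm M) _; rewrite ltrDl.
Qed.

Lemma inbox_hcube r : (0 < r)%R -> inbox r `<=` hcube (const_mx (- (2 * r)))%R (4 * r).
Proof. move=> r0 x xr i; have := xr i; rewrite !mxE ler_norml; lra. Qed.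

Lemma hcube_inbox a s : exists2 r, (0 < r)%R & hcube a s `<=` inbox r.
Proof.
exists (`|a| + `|s| + 1)%R; first by rewrite ltr_pwDr// addr_ge0.
move=> x xa i; have := xa i; have := ler_coord a i; have := ler_norm s.
rewrite !ler_norml; lra.
Qed.

Lemma leb_inbox_lty r : leb (inbox r) < +oo.
Proof.
apply: (@le_lt_trans _ _ (leb (inbox (`|r| + 1)%R))).
  apply: le_leb => x xr i; apply: le_trans (xr i) _.
  by apply: (le_trans (ler_norm r)); rewrite lerDl.
have r0 : (0 < `|r| + 1)%R by rewrite ltr_pwDr.
apply: le_lt_trans (le_leb (inbox_hcube r0)) _.
by rewrite leb_hcube ?ltry// mulr_gt0.
Qed.

Lemma leb_bounded_lty X : bounded_set X -> leb X < +oo.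
Proof.
move=> /bounded_inbox[r r0 Xr]; apply: le_lt_trans (le_leb Xr) _.
exact: leb_inbox_lty.
Qed.

End boxes.

(** * Translation invariance and finite measures of basis sets *)

Section basis.
Variables (R : realType) (n : nat).
Local Notation V := 'rV[R]_n.
Variable B : V -> set (set V).
Hypothesis (Bb : is_basis B) (Bh : homothecy_invariant B).

(** For ratio other than 1 the map is a homothecy about its fixed point [(1 - t)^-1 *: v]; a
    translation is composed of two such maps, of ratios 2 and 1/2. *)
Lemma basis_aff v (t : R) x Q : (0 < t)%R -> B x Q -> B (aff v t x) (aff v t @` Q).
Proof.
have main w r y P : (0 < r)%R -> r != 1%R -> B y P -> B (aff w r y) (aff w r @` P).
  move=> r0 r1 yP; have -> : aff w r = homothecy ((1 - r)^-1 *: w)%R r.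
    by rewrite homothecyE scalerA mulfV ?scale1r// subr_eq0 eq_sym.
  exact: Bh.
move=> t0 xQ; have [->|t1] := eqVneq t 1%R; last exact: main.
have h2 : (2 : R)%R != 1%R by lra.
have h2' : (2^-1 : R)%R != 1%R by lra.
have := main v (2^-1)%R _ _ _ h2' (main 0%R 2%R _ _ _ h2 xQ).
rewrite aff_comp aff_comp_image scaler0 addr0 mulVf; last by lra.
by apply; lra.
Qed.

Lemma basis_prop x Q : B x Q -> [/\ bounded_lmeasurable Q, 0 < leb Q & Q x].
Proof. by have [+ _] := Bb x; exact. Qed.

Lemma basis_ex x : exists Q, B x Q.
Proof. by have [_ [Q_ [Q_B _]]] := Bb x; exists (Q_ 0%N). Qed.

Lemma basis_leb x Q : B x Q -> exists2 q : R, (0 < q)%R & leb Q = q%:E.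
Proof.
move=> /basis_prop[[bQ mQ] Q0 Qx]; exists (fine (leb Q)).
  by rewrite fine_gt0// Q0/=; exact: leb_bounded_lty.
by rewrite fineK// ge0_fin_numE ?leb_ge0//; exact: leb_bounded_lty.
Qed.

(** A set of the basis has positive measure and lies in a cube, whose measure is a multiple of
    [kappa]. *)
Lemma kappa_gt0 : (0 < kappa R n)%R.
Proof.
have [Q /basis_prop[[/bounded_inbox[r r0 Qr] _] Q0 _]] := basis_ex 0%R.
have := lt_le_trans Q0 (le_leb (subset_trans Qr (inbox_hcube r0))).
rewrite leb_hcube ?mulr_gt0// lte_fin pmulr_rgt0// exprn_gt0// mulr_gt0//.
Qed.

End basis.

(** * Convex sets of positive measure *)

Section convex_interior.
Variables (R : realType) (n : nat).
Local Notation V := 'rV[R]_n.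
Implicit Types (a b p v x y : V) (t r : R) (Q : set V).

Lemma convex_set_comb Q x y t : convex_set (Q : set (convex_lmodType V)) ->
  Q x -> Q y -> (0 <= t <= 1)%R -> Q (t *: x + (1 - t) *: y)%R.
Proof.
move=> cQ Qx Qy /andP[t0 t1].
have /set_mem := cQ x y (Itv01 t0 t1) (mem_set Qx) (mem_set Qy).
by [].
Qed.

Lemma finite_min (f : 'I_n -> R) : (forall i, 0 < f i)%R ->
  exists2 e : R, (0 < e)%R & forall i, (e <= f i)%R.
Proof.
move=> f0; exists (\big[Num.min/1%R]_i f i)%R => [|i].
  by apply/lt_bigmin.
by apply: bigmin_le_cond.
Qed.

Lemma segment_hit (p v q : R) : (p <= v <= q)%R ->
  exists2 t : R, (0 <= t <= 1)%R & (t * q + (1 - t) * p = v)%R.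
Proof.
move=> /andP[pv vq]; have [pq|pq] := eqVneq p q.
  by exists 0%R; lra.
have qp : (0 < q - p)%R by rewrite subr_gt0 lt_neqAle pq (le_trans pv).
exists ((v - p) / (q - p))%R.
  rewrite divr_ge0 ?subr_ge0 ?(ltW qp)//= ?ler_pdivrMr// ?mul1r; lra.
by field; rewrite gt_eqF.
Qed.

(** Two points on either side of [v] in one coordinate are joined by a segment, on which that
    coordinate takes the value of [v]. Doing this for one coordinate after the other reaches [v]. *)
Lemma convex_orthants Q v : convex_set (Q : set (convex_lmodType V)) ->
  (forall s : 'I_n -> bool, exists2 y, Q y & forall i,
     (if s i then v ord0 i <= y ord0 i else y ord0 i <= v ord0 i)%R) ->
  Q v.
Proof.
move=> cQ H.
suff /(_ n (leqnn n) xpredT)[y Qy yv] : forall k : nat, (k <= n)%N ->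
    forall s : 'I_n -> bool, exists2 y, Q y & forall i : 'I_n,
     (if (i < k)%N then y ord0 i = v ord0 i else
      if s i then v ord0 i <= y ord0 i else y ord0 i <= v ord0 i)%R.
  rewrite (_ : v = y)//; apply/rowP => i.
  by have := yv i; rewrite ltn_ord => ->.
elim=> [_ s|k IH kn s]; first by have [y Qy yv] := H s; exists y.
pose K := Ordinal kn.
(* [y1] and [y0] agree with the pattern [s] except that coordinate [K] is forced above, respectively
   below, that of [v]. *)
have [y1 Qy1 y1v] := IH (ltnW kn) (fun j => (j == K) || s j).
have [y0 Qy0 y0v] := IH (ltnW kn) (fun j => (j != K) && s j).
have [] := @segment_hit (y0 ord0 K) (v ord0 K) (y1 ord0 K).
  have := y1v K; have := y0v K; rewrite /= ltnn eqxx /= => ->; exact.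
move=> t t01 tv; exists (t *: y1 + (1 - t) *: y0)%R; first exact: convex_set_comb.
move=> i; have := y1v i; have := y0v i; rewrite !mxE (ltnS i k) (leq_eqVlt i k).
have [->|iK] := eqVneq i K; first by rewrite /= eqxx ltnn.
rewrite (_ : (i == k :> nat) = false) /=; last by apply/negP => /eqP iK'; move/eqP: iK; apply; exact: val_inj.
case: ifP => _; first by move=> -> ->; rewrite -mulrDl addrC subrK mul1r.
by case: ifP => _; nra.
Qed.

(** The corner is a copy [C] of the box at ratio 1/4, so it takes up the share 4^-n of the measure
    of the box; splitting the box along [C] leaves the rest for [Q]. *)
Lemma leb_corner_miss Q a b (s : 'I_n -> bool) :
  (forall i, a ord0 i < b ord0 i)%R ->
  (forall y, Q y -> ~ forall i,
     (if s i then b ord0 i - (b ord0 i - a ord0 i) / 4 <= y ord0 i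
      else y ord0 i <= a ord0 i + (b ord0 i - a ord0 i) / 4)%R) ->
  leb (Q `&` box_set (Some (a, b))) <=
    (1 - (4^-1) ^+ n)%:E * (box_vol (Some (a, b)))%:E.
Proof.
move=> ab miss; set bx := box_set _.
(* Chosen so that the map of ratio 1/4 fixes the vertex of the box selected by [s]. *)
pose w : V := (\row_i (3 / 4 * (if s i then b ord0 i else a ord0 i)))%R.
pose C := aff w (4^-1)%R @` bx.
have Cb : C `<=` bx.
  move=> _ [x /= xab <-] i; rewrite affE mxE.
  by have := ab i; have /andP[] := xab i; case: (s i) => ? ? ?; apply/andP; split; lra.
have p4 : (0 < 4^-1 :> R)%R by lra.
have mC : lmeasurable C by apply: lmeasurable_aff => //; exact: lmeasurable_box.
have fb : leb bx \is a fin_num.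
  rewrite ge0_fin_numE ?leb_ge0//.
  exact: le_lt_trans (leb_box_le _) (ltry _).
have e4 : (((4^-1) ^+ n : R) <= 1)%R by apply: exprn_ile1; lra.
rewrite -/bx; apply: (@le_trans _ _ (leb (bx `&` ~` C))).
  apply: le_leb => y [Qy bxy]; split => // -[x xab yE].
  apply: (miss _ Qy) => i; rewrite -yE affE mxE.
  by have := ab i; have /andP[] := xab i; case: (s i) => ? ? ?; lra.
apply: (@le_trans _ _ ((1 - (4^-1) ^+ n)%:E * leb bx)); last first.
  by apply: lee_wpmul2l; [rewrite lee_fin; lra|exact: leb_box_le].
rewrite EFinB muleBl// mul1e.
rewrite leeBrDr ?fin_numM//.
rewrite -(leb_aff w)// -/C addeC.
move: mC; rewrite lmeasurableE => /(_ bx) {1}->.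
by rewrite (setIidr Cb).
Qed.

(* Some box of a nearly optimal cover is nearly filled by [Q], so [Q] meets the
   homothetic images of ratio 1/4 of this box at its 2^n corners; a convex set
   that meets all corners contains the middle of the box. *)
Lemma convex_interior Q : convex_set (Q : set (convex_lmodType V)) ->
  0 < leb Q -> leb Q < +oo ->
  exists p : V, exists2 r, (0 < r)%R &
    forall y, (forall i, `|y ord0 i - p ord0 i| <= r)%R -> Q y.
Proof.
move=> cQ Q0 Qoo.
suff [a [b [ab H]]] : exists a b : V, (forall i, a ord0 i < b ord0 i)%R /\
    forall s : 'I_n -> bool, exists2 y, Q y & forall i,
     (if s i then b ord0 i - (b ord0 i - a ord0 i) / 4 <= y ord0 i
      else y ord0 i <= a ord0 i + (b ord0 i - a ord0 i) / 4)%R.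
  have [|r r0 rf] := @finite_min (fun i => (b ord0 i - a ord0 i) / 4)%R.
    by move=> i; rewrite divr_gt0// subr_gt0.
  exists (2^-1 *: (a + b))%R, r => // v vr.
  apply: convex_orthants => // s; have [y Qy ys] := H s; exists y => // i.
  have := ys i; have := vr i; have := rf i; rewrite !mxE ler_norml.
  by case: ifP => _; lra.
apply: contrapT => nH.
have e4 : (0 < (4^-1) ^+ n :> R)%R by rewrite exprn_gt0//; lra.
have e41 : (((4^-1) ^+ n : R) <= 1)%R by apply: exprn_ile1; lra.
have key (c : option (V * V)) :
    leb (Q `&` box_set c) <= (1 - (4^-1) ^+ n)%:E * (box_vol c)%:E.
  have B0 : 0 <= (1 - (4^-1) ^+ n)%:E * (box_vol c)%:E.
    by apply: mule_ge0; [rewrite lee_fin; lra|exact: box_vol_ge0].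
  case: c B0 => [[a b]|] B0; last by rewrite /= setI0 measure0.
  have [ab|] := pselect (forall i, a ord0 i < b ord0 i)%R; last first.
    move=> /existsNP[i /negP]; rewrite -leNgt => ba.
    rewrite (_ : _ `&` _ = set0) ?measure0//; apply/seteqP; split => // y [_ /(_ i)].
    by move=> /andP[ay yb]; have := lt_le_trans ay yb; rewrite ltNge ba.
  have /existsNP[s ns] : ~ forall s : 'I_n -> bool, exists2 y, Q y & forall i,
     (if s i then b ord0 i - (b ord0 i - a ord0 i) / 4 <= y ord0 i
      else y ord0 i <= a ord0 i + (b ord0 i - a ord0 i) / 4)%R.
    by move=> h; apply: nH; exists a, b.
  apply: (@leb_corner_miss _ _ _ s) => // y Qy ys; apply: ns; by exists y.
have Qf : leb Q \is a fin_num by rewrite ge0_fin_numE// ltW.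
(* Summing [key] over an arbitrary cover of [Q] gives this bound, which is absurd for a positive
   finite measure. *)
suff : leb Q <= (1 - (4^-1) ^+ n)%:E * leb Q.
  rewrite -(fineK Qf) -EFinM lee_fin.
  have : (0 < fine (leb Q))%R by rewrite fine_gt0// Q0.
  nra.
(* The factor 1 - 4^-n is 0 when n = 0 and cannot be divided by; in that case [key] makes all traces
   of [Q] on boxes null. *)
have [e1|e1] := eqVneq ((4^-1) ^+ n)%R (1 : R)%R.
  have -> : leb Q = 0; last by rewrite mule0.
  apply/eqP; rewrite eq_le leb_ge0 andbT.
  have [c cQ'] : exists c : nat -> option (V * V), Q `<=` \bigcup_k (Q `&` box_set (c k)).
    have /ereal_inf_lt[_ [c cQc _] _] : lebesgue_outer Q < +oo by [].
    by exists c => x Qx; have [k _ ck] := cQc _ Qx; exists k.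
  apply: (le_trans (le_leb cQ')).
  apply: (le_trans (lebesgue_outer_sigma_subadditive (fun k => Q `&` box_set (c k)))).
  apply: (@le_trans _ _ (\sum_(k <oo) ((1 - (4^-1) ^+ n)%:E * (box_vol (c k))%:E))).
    by apply: lee_nneseries => [k _ _|k _]; [exact: leb_ge0|exact: key].
  by rewrite eseries0// => k _ _; rewrite e1 subrr mul0e.
rewrite muleC -lee_pdivrMr; last by rewrite subr_gt0 lt_neqAle e1.
apply: le_ereal_inf_tmp => _ [c cQc <-].
rewrite lee_pdivrMr; last by rewrite subr_gt0 lt_neqAle e1.
rewrite muleC -nneseriesZl; last by move=> k _; exact: box_vol_ge0.
apply: (@le_trans _ _ (leb (\bigcup_k (Q `&` box_set (c k))))).
  by apply: le_leb => x Qx; have [k _ ck] := cQc _ Qx; exists k.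
apply: (le_trans (lebesgue_outer_sigma_subadditive (fun k => Q `&` box_set (c k)))).
by apply: lee_nneseries => [k _ _|k _]; [exact: leb_ge0|exact: key].
Qed.

End convex_interior.

(** * Elongated convex sets *)

Section elongation.
Variables (R : realType) (n : nat).
Local Notation V := 'rV[R]_n.
Implicit Types (a b p v x y : V) (t r : R) (Q X : set V).

(** The pieces are split off one at a time by their own measurability, so [X] may be any set. *)
Lemma leb_packing (N : nat) (F : nat -> set V) (m : \bar R) X : 0 <= m ->
  (forall j, (j < N)%N -> [/\ lmeasurable (F j), m <= leb (F j) & F j `<=` X]) ->
  (forall j k, (j < k < N)%N -> F j `&` F k = set0) ->
  N%:R%:E * m <= leb X.
Proof.
move=> m0; elim: N X => [|N IH] X FX dF; first by rewrite mul0e leb_ge0.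
have [+ mN NX] := FX N (ltnSn N); rewrite lmeasurableE => /(_ X) ->.
rewrite -natr1 EFinD ge0_muleDl// mul1e addeC; apply: leeD.
  by rewrite (setIidr NX).
apply: IH => [j jN|j k /andP[jk kN]]; last by apply: dF; rewrite jk ltnW.
have [mF mm jX] := FX j (ltnW jN); split => // x Fx; split; first exact: jX.
by move=> FNx; have := dF j N; rewrite jN ltnSn => /(_ isT)/seteqP[/(_ x) + _]; apply.
Qed.

(* The homothetic images of the intersection towards [p] with the factors
   [1 - th j], [th j <= 1/2], are pairwise disjoint subsets of [Q]. *)
Lemma elongation Q p (i : 'I_n) r (N : nat) :
  convex_set (Q : set (convex_lmodType V)) -> lmeasurable Q ->
  Q p -> (0 < r)%R -> (6 * r * N%:R <= `|p ord0 i|)%R ->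
  N%:R%:E * leb (Q `&` hcube (const_mx (- r))%R (2 * r)%R) <= (2 ^+ n)%:E * leb Q.
Proof.
move=> cQ mQ Qp r0 rN; set C := Q `&` _.
have [->|N0] := posnP N; first by rewrite mul0e mule_ge0 ?leb_ge0// lee_fin exprn_ge0.
have P0 : (0 < `|p ord0 i|)%R.
  by apply: lt_le_trans rN; rewrite mulr_gt0 ?ltr0n// mulr_gt0.
have mC : lmeasurable C by apply: measurableI => //; exact: lmeasurable_hcube.
have Cr x : C x -> (`|x ord0 i| <= r)%R.
  move=> [_ /(_ i)]; rewrite mxE => /andP[? ?]; rewrite ler_norml; apply/andP; split; lra.
(* Each step moves coordinate [i] by 3 r, more than the width 2 r of [C], which makes the images
   disjoint; the bound on [p] keeps the first N values at most 1/2. *)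
pose th (j : nat) : R := (3 * r * j%:R / `|p ord0 i|)%R.
have th2 j : (j < N)%N -> (0 <= th j <= 2^-1)%R.
  move=> jN; have jNR : (j%:R <= N%:R :> R)%R by rewrite ler_nat ltnW.
  have r00 := ltW r0; rewrite /th divr_ge0 ?mulr_ge0 ?ler0n//= ler_pdivrMr//.
  have : (r * j%:R <= r * N%:R)%R by rewrite ler_pM2l.
  lra.
pose F j := aff (th j *: p) (1 - th j)%R @` C.
have th1 j : (j < N)%N -> (0 < 1 - th j)%R by move=> /th2; lra.
rewrite -lee_pdivrMl ?exprn_gt0// muleCA -exprVn.
apply: (@leb_packing N F) => [|j jN|j k /andP[jk kN]].
- by rewrite mule_ge0 ?leb_ge0// lee_fin exprn_ge0.
- split; first by apply: lmeasurable_aff => //; exact: th1.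
    rewrite leb_aff ?th1//; apply: lee_wpmul2r; first exact: leb_ge0.
    by rewrite lee_fin; apply: lerXn2r; rewrite ?nnegrE; have := th2 _ jN; lra.
  move=> _ [x [Qx _] <-]; apply: convex_set_comb => //; have := th2 _ jN; lra.
apply/seteqP; split => // z [[x Cx xz] [y Cy yz]].
have jN := ltn_trans jk kN.
have : (aff (th j *: p) (1 - th j) x)%R ord0 i = (aff (th k *: p) (1 - th k) y)%R ord0 i.
  by rewrite xz yz.
rewrite !affE !mxE => E.
have xr : (`|(1 - th j) * x ord0 i| <= r)%R.
  rewrite normrM (gtr0_norm (th1 _ jN)).
  have := Cr _ Cx; have := th2 _ jN; have := normr_ge0 (x ord0 i); nra.
have yr : (`|(1 - th k) * y ord0 i| <= r)%R.
  rewrite normrM (gtr0_norm (th1 _ kN)).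
  have := Cr _ Cy; have := th2 _ kN; have := normr_ge0 (y ord0 i); nra.
have jk1 : (j%:R + 1 <= k%:R :> R)%R by rewrite natr1 ler_nat.
have : (`|(th k - th j) * p ord0 i| <= r + r)%R.
  rewrite (_ : ((th k - th j) * p ord0 i)%R =
    ((1 - th j) * x ord0 i - (1 - th k) * y ord0 i)%R); last by lra.
  by apply: le_trans (ler_normB _ _) _; exact: lerD.
rewrite normrM /th -mulrBl -mulrBr normrM normfV normr_id divfK ?gt_eqF//.
have d0 : (1 <= k%:R - j%:R :> R)%R by lra.
rewrite ger0_norm; last by rewrite !mulr_ge0//; lra.
nra.
Qed.

Lemma lebU X1 X2 : leb (X1 `|` X2) <= leb X1 + leb X2.
Proof. exact: (@outer_measureU2 V R (@lebesgue_outer R n) X1 X2). Qed.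

Lemma leb_cover (T : finType) (P : {set T}) (F : T -> set V) X (c : \bar R) : 0 <= c ->
  X `<=` [set x | exists2 k, k \in P & F k x] ->
  (forall k, k \in P -> leb (F k) <= c) -> leb X <= #|P|%:R%:E * c.
Proof.
move=> c0 XF Fc; apply: (@le_trans _ _ (leb (\big[setU/set0]_(k in P) F k))).
  by apply: le_leb => x /XF[k kP Fx]; rewrite -bigcup_seq_cond; exists k => //=; rewrite mem_index_enum.
apply: (@le_trans _ _ (\sum_(k in P) leb (F k))).
  elim/big_ind2 : _ => //; first by rewrite measure0.
  move=> x1 y1 x2 y2 h1 h2; apply: le_trans (lebU _ _) _; exact: leeD.
apply: (@le_trans _ _ (\sum_(k in P) c)); first by apply: lee_sum => k; exact: Fc.
rewrite big_const; elim: #|P| => [|k IH]; first by rewrite mul0e.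
by rewrite -natr1 EFinD ge0_muleDl// mul1e addeC; apply: leeD.
Qed.

End elongation.

(** * Irregular bases *)

Lemma nth_root_exists (R : realType) (n : nat) (q : R) : (0 < n)%N -> (0 < q)%R ->
  exists2 t : R, (0 < t)%R & (t ^+ n = q)%R.
Proof.
move=> n0 q0; exists (q `^ (n%:R^-1))%R; first exact: powR_gt0.
rewrite -powR_mulrn ?powR_ge0// -powRrM mulVf ?powRr1 ?ltW//.
by rewrite pnatr_eq0 -lt0n.
Qed.

Lemma exists_nat_gt (R : realType) (x : R) : exists2 N : nat, (0 < N)%N & (x < N%:R)%R.
Proof.
exists (Num.truncn `|x|).+1 => //; apply: le_lt_trans (ler_norm x) _.
by have /andP[] := truncn_itv (normr_ge0 x).
Qed.

Section irregular.
Variables (R : realType) (n : nat).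
Hypothesis n0 : (0 < n)%N.
Local Notation V := 'rV[R]_n.
Variable B : V -> set (set V).
Hypotheses (Bb : is_basis B) (Bh : homothecy_invariant B) (Bc : convex_basis B).
Hypothesis irr : ~ regular_basis B.

(** A set that violates regularity with constant [c] is moved to 0 and rescaled to measure 1. Were
    it contained in [inbox L], the surrounding cube would show that [c] suffices. *)
Lemma irregular_elongated (L : R) : (0 < L)%R -> exists Q, [/\ B 0%R Q, leb Q = 1 &
  exists2 p, Q p & exists i, (L < `|p ord0 i|)%R].
Proof.
(* The second summand is the measure of a half-open cube containing [inbox L]; the 1 ensures
   [1 <= c]. *)
move=> L0; pose c := (1 + (4 * L) ^+ n * kappa R n)%R.
have k0 := kappa_gt0 Bb.
have c1 : (1 <= c)%R by rewrite lerDl mulr_ge0 ?exprn_ge0 ?mulr_ge0 ?(ltW L0) ?(ltW k0).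
have /existsNP[x /existsNP[Q /not_implyP[xQ nQ]]] : ~ forall x Q, B x Q -> exists (a : V) (s : R),
      [/\ (0 < s)%R, Q `<=` cube a s & leb (cube a s) <= c%:E * leb Q].
  by move=> h; apply: irr; exists c.
have [q q0 Qq] := basis_leb Bb xQ.
have [|t t0 tq] := @nth_root_exists _ n q^-1%R n0; first by rewrite invr_gt0.
have := basis_aff Bh (- (t *: x))%R t0 xQ.
rewrite {1}/aff addNr => Q'B.
exists (aff (- (t *: x))%R t @` Q); split => //.
  by rewrite leb_aff// tq Qq -EFinM mulVf ?gt_eqF.
apply: contrapT => small; apply: nQ.
pose w := affV (- (t *: x))%R t.
have ti0 : (0 < t^-1)%R by rewrite invr_gt0.
exists (aff w t^-1 (const_mx (- L))%R), (t^-1 * (2 * L))%R; split.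
- by rewrite !mulr_gt0.
- rewrite -aff_cube// => y Qy; exists (aff (- (t *: x)) t y)%R; last exact: affK.
  move=> i; rewrite mxE.
  have : (`|aff (- (t *: x)) t y ord0 i| <= L)%R.
    rewrite leNgt; apply/negP => Ly; apply: small.
    by exists (aff (- (t *: x)) t y)%R; [exists y|exists i].
  by rewrite ler_norml => /andP[? ?]; apply/andP; split; lra.
rewrite -aff_cube// leb_aff// exprVn tq invrK Qq muleC; apply: lee_wpmul2r.
  by rewrite lee_fin ltW.
apply: (@le_trans _ _ (leb (inbox L))).
  apply: le_leb => y Ly i; have /andP[] := Ly i; rewrite mxE => ? ?.
  by rewrite ler_norml; apply/andP; split; lra.
apply: le_trans (le_leb (inbox_hcube L0)) _.
by rewrite leb_hcube ?mulr_gt0// lee_fin /c lerDr.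
Qed.

(** Each new set [Q] is so long that at most 2^-(n+1) of its measure lies near the earlier ones. It
    is added shrunk by 1/2 towards an interior point: this keeps the measure 2^-n, half of which is
    new, and leaves a uniform margin [rho] inside [Q]. *)
Lemma irregular_pile (m : nat) : exists (A : set V) (r rho : R),
  [/\ (0 < r)%R && (0 < rho)%R, lmeasurable A, A `<=` inbox r,
    (m%:R * 2^-1 ^+ n.+1)%R%:E <= leb A &
    forall a, A a -> exists Q, [/\ B 0%R Q, leb Q = 1, Q `<=` inbox r &
      forall y : V, (forall i, `|y ord0 i - a ord0 i| <= rho)%R -> Q y]].
Proof.
elim: m => [|m [A [r [rho [/andP[r0 rho0] mA Ar Am AQ]]]]].
  exists set0, 1%R, 1%R; split => //; [by rewrite ltr01|exact: measurable0|].
  by rewrite mul0r leb_ge0.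
pose N := (2 ^ (n + n.+1))%N.
have N0 : (0 < N)%N by rewrite expn_gt0.
(* The length required by [elongation] for radius 2 r. The radius is doubled so that the half-open
   cube [H] contains [inbox r]; [N] is 2^n times 2^(n+1), the first factor being the loss in
   [elongation]. *)
have [|Q [QB Q1 [p Qp [i pi]]]] := @irregular_elongated (6 * (2 * r) * N%:R)%R.
  by rewrite !mulr_gt0// ltr0n.
have [[bQ mQ] _ _] := basis_prop Bb QB.
have cQ := Bc QB.
have r20 : (0 < 2 * r)%R by rewrite mulr_gt0.
have := elongation cQ mQ Qp r20 (ltW pi); set H := hcube _ _ => NQH.
have QH : leb (Q `&` H) <= (2^-1 ^+ n.+1)%R%:E.
  rewrite Q1 mule1 -lee_pdivlMl ?ltr0n// in NQH; apply: (le_trans NQH).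
  rewrite -EFinM lee_fin /N natrX exprD invfM mulrAC mulVf ?mul1r; last first.
    by rewrite expf_neq0.
  by rewrite exprVn.
have Q01 : 0 < leb Q by rewrite Q1.
have Qoo : leb Q < +oo by rewrite Q1 ltry.
have [p0 [r1 r10 pQ]] := convex_interior cQ Q01 Qoo.
have [r2 r20' Qr2] := bounded_inbox bQ.
pose D := aff (2^-1 *: p0)%R 2^-1%R @` Q.
have h0 : (0 < 2^-1 :> R)%R by lra.
have mD : lmeasurable D by exact: lmeasurable_aff.
have D2 : leb D = (2^-1 ^+ n)%R%:E by rewrite leb_aff// Q1 mule1.
have Qp0 : Q p0 by apply: pQ => j; rewrite subrr normr0 ltW.
have DQ : D `<=` Q.
  move=> _ [q Qq <-]; rewrite /aff (_ : 2^-1 *: q = (1 - 2^-1) *: q)%R.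
    by apply: convex_set_comb => //; lra.
  by congr (_ *: _)%R; lra.
have mH : lmeasurable H by exact: lmeasurable_hcube.
have AH : A `<=` H.
  move=> x /Ar xr j; have := xr j; rewrite !mxE ler_norml => /andP[? ?].
  by apply/andP; split; lra.
have rr : (r <= r + r2)%R /\ (r2 <= r + r2)%R by split; lra.
exists (A `|` D), (r + r2)%R, (Num.min rho (r1 / 2))%R; split.
- by rewrite addr_gt0//= lt_min rho0 divr_gt0.
- exact: measurableU.
- move=> x [/Ar xr j|/DQ /Qr2 xr j]; [have := xr j|have := xr j]; lra.
- have := mH; rewrite lmeasurableE => /(_ (A `|` D)) ->.
  have DH : (2^-1 ^+ n.+1)%R%:E <= leb (D `&` ~` H).
    have := mH; rewrite lmeasurableE => /(_ D); rewrite D2 => E.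
    have : (2^-1 ^+ n)%R%:E <= (2^-1 ^+ n.+1)%R%:E + leb (D `&` ~` H).
      rewrite E; apply: leeD => //; apply: le_trans QH; apply: le_leb.
      exact: setSI.
    rewrite -leeBlDl// -EFinB exprS (_ : (_ - _)%R = (2^-1 * 2^-1 ^+ n)%R)//.
    lra.
  rewrite -natr1 mulrDl mul1r EFinD; apply: leeD.
    by apply: (le_trans Am); apply: le_leb => x Ax; split; [left|exact: AH].
  by apply: (le_trans DH); apply: le_leb => x [Dx nHx]; split => //; right.
- move=> a [Aa|[q Qq <-]].
    have [P [PB P1 Pr aP]] := AQ a Aa; exists P; split => //.
      by move=> x /Pr xr j; have := xr j; lra.
    by move=> y ya; apply: aP => j; have := ya j; rewrite le_min => /andP[].
  exists Q; split => //; first by move=> x /Qr2 xr j; have := xr j; lra.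
  (* As [y] is within [r1 / 2] of the midpoint of [q] and [p0], the reflection of [q] in [y] is
     within [r1] of [p0], hence in [Q]; and [y] is the midpoint of [q] and this reflection. *)
  move=> y yq; rewrite (_ : y = 2^-1 *: q + (1 - 2^-1) *: (2 *: y - q))%R.
    apply: convex_set_comb => //; last lra.
    apply: pQ => j; have := yq j; rewrite le_min => /andP[_].
    rewrite affE !mxE !ler_norml => /andP[? ?]; apply/andP; split; lra.
  by apply/rowP => j; rewrite !mxE; lra.
Qed.

Definition gridpt (N : nat) (k : {ffun 'I_n -> 'I_N}) : V := (\row_i (k i)%:R)%R.

(* Indices are reflected: [a] lies in the cell [C k] when [(r1 - a) / d] has
   integer part [k]. Thus translating by any [x] in the cell of [k] a set around
   [a] makes it contain one and the same cube [hcube e d]. *)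
Lemma irregular_cells (m : nat) : exists (d L : R) (N : nat) (e : V) (I : {set {ffun 'I_n -> 'I_N}}),
  [/\ (0 < d < 1)%R, (0 < L)%R,
    (m%:R * 2^-1 ^+ n.+1 <= #|I|%:R * (d ^+ n * kappa R n))%R &
    forall k x, k \in I -> hcube (d *: gridpt k)%R d x -> exists Q,
      [/\ B x Q, leb Q = 1, hcube e d `<=` Q &
        forall y : V, Q y -> forall i, (`|y ord0 i - x ord0 i| <= L)%R]].
Proof.
have [A [r [rho [/andP[r0 rho0] mA Ar Am AQ]]]] := irregular_pile m.
pose r1 := (2 * r)%R; have r10 : (0 < r1)%R by rewrite mulr_gt0.
(* The two summands give [d < 1] and [2 * d < rho] for the side [d] of the cells. *)
have [N N0 NN] := exists_nat_gt ((2 * r1) * (1 + 2 / rho))%R.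
have N0R : (0 < N%:R :> R)%R by rewrite ltr0n.
pose d := (2 * r1 / N%:R)%R.
have d0 : (0 < d)%R by rewrite divr_gt0// mulr_gt0.
have dN : (d * N%:R = 2 * r1)%R by rewrite divfK// gt_eqF.
have rho0' : (0 < 2 / rho)%R by rewrite divr_gt0.
have r100 : (0 <= 2 * r1 * (2 / rho))%R by exact: ltW (mulr_gt0 (mulr_gt0 (ltr0Sn R 1) r10) rho0').
have d1 : (d < 1)%R.
  by rewrite ltr_pdivrMr// mul1r; apply: le_lt_trans NN; rewrite mulrDr mulr1 lerDl.
have drho : (2 * d < rho)%R.
  rewrite -ltr_pdivlMl// /d ltr_pdivrMr//.
  have E : (2 * r1 * (2 / rho) < N%:R)%R.
    by apply: le_lt_trans NN; rewrite mulrDr mulr1 lerDr ltW// mulr_gt0.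
  have : (2 * r1 * (2 / rho) * (rho / 2) < N%:R * (rho / 2))%R by rewrite ltr_pM2r// divr_gt0.
  rewrite (_ : 2 * r1 * (2 / rho) * (rho / 2) = 2 * r1)%R; last by field; rewrite gt_eqF.
  lra.
pose C (k : {ffun 'I_n -> 'I_N}) := hcube (const_mx (r1 - d) - d *: gridpt k)%R d.
pose I := finset (fun k : {ffun 'I_n -> 'I_N} => `[< exists2 a, A a & C k a >]).
have CP k a : C k a -> forall i,
    (r1 - d * (k i)%:R - d < a ord0 i <= r1 - d * (k i)%:R)%R.
  by move=> Ca i; have := Ca i; rewrite !mxE => /andP[? ?]; apply/andP; split; lra.
exists d, (r1 + r)%R, N, (const_mx r1), I; split.
- by rewrite d0.
- by rewrite addr_gt0.
- rewrite -lee_fin; apply: (le_trans Am); rewrite EFinM.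
  apply: (@leb_cover R n _ I C) => [|a Aa|k _].
  + by rewrite lee_fin mulr_ge0 ?exprn_ge0 ?(ltW d0)// ltW// (kappa_gt0 Bb).
  + have ur i : (0 <= (r1 - a ord0 i) / d < N%:R)%R.
      have := Ar _ Aa i; rewrite ler_norml => /andP[? ?].
      rewrite divr_ge0 ?ltr_pdivrMr ?(ltW d0)//; first by rewrite (mulrC N%:R) dN /r1; lra.
      by rewrite /r1; lra.
    have kN i : (Num.truncn ((r1 - a ord0 i) / d) < N)%N.
      by have /andP[u0 uN] := ur i; rewrite truncn_lt_nat.
    pose k := [ffun i => Ordinal (kN i)].
    have Cka : C k a.
      move=> i; rewrite !mxE !ffunE /=; have /andP[u0 _] := ur i.
      have /andP[] := truncn_itv u0.
      rewrite ler_pdivlMr// ltr_pdivrMr// -natr1 => ? ?; apply/andP; split; lra.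
    by exists k => //; rewrite inE; apply/asboolP; exists a.
  + by rewrite leb_hcube.
move=> k x; rewrite inE => /asboolP[a Aa /CP ka] xk.
have [Q [QB Q1 Qr aQ]] := AQ a Aa.
exists (aff x 1 @` Q); split.
- have := basis_aff Bh x (@ltr01 R) QB.
  by rewrite {1}/aff scaler0 addr0.
- by rewrite leb_aff// expr1n mul1e.
(* For [y] in the fixed cube and [x] in the cell of [k], the difference [y - x] is within 2 d of any
   point of [C k], in particular of [a]; the margin [rho] is larger. *)
- move=> y ye; exists (y - x)%R; last by rewrite /aff scale1r addrC subrK.
  apply: aQ => i; have := ka i; have := xk i; have := ye i; rewrite !mxE.
  move=> /andP[? ?] /andP[? ?] /andP[? ?]; rewrite ler_norml; apply/andP; split; lra.
- move=> _ [q Qq <-] i; rewrite affE mul1r addrAC subrr add0r.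
  by have := Qr _ Qq i; lra.
Qed.

End irregular.

(** * Grids of cubes *)

(** A maximiser [Z] of a potential replaces the successive choices. Comparison with the empty set
    bounds the size of [Z]. Adding one more [z] gains little, and since every uncovered [u] has at
    least [d] relatives, summing the gains over all [z] bounds the number of uncovered [u]. *)
Lemma greedy_cover (W U : finType) (r : W -> U -> bool) (d : nat) : (0 < d)%N ->
  (forall u, (d <= #|[pred w | r w u]|)%N) ->
  exists Z : {set W}, (#|Z| * d <= 2 * #|W|)%N /\
    (2 * #|[pred u | ~~ [exists w in Z, r w u]]| <= #|U|)%N.
Proof.
move=> d0 rd.
have [U0|Upos] := posnP #|U|.
  exists finset.set0; rewrite finset.cards0 mul0n; split => //.
  by rewrite U0 (leq_trans (leq_mul (leqnn 2) (max_card _)))// U0.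
pose cov (Z : {set W}) := [pred u | [exists w in Z, r w u]].
pose unc (Z : {set W}) := [pred u | ~~ [exists w in Z, r w u]].
have covC Z : (#|cov Z| + #|unc Z| = #|U|)%N by rewrite (cardC (cov Z)).
have ZC (Z : {set W}) : (#|Z| + #|finset.setC Z| = #|W|)%N by exact: finset.cardsC.
(* A maximiser of [2 |W| |cov Z| - d |U| |Z|], the sign being absorbed by
   counting the complement of [Z]. *)
pose Phi Z := (2 * #|W| * #|cov Z| + d * #|U| * #|finset.setC Z|)%N.
case: (@arg_maxnP _ finset.set0 xpredT Phi isT) => Z _ Zmax; exists Z; split.
  have := Zmax finset.set0 isT; rewrite /Phi.
  have := ZC Z; have := covC Z; have := ZC finset.set0; rewrite finset.cards0.
  rewrite add0n => -> HU HW.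
  rewrite -(leq_pmul2r Upos).
  nia.
have step z : (2 * #|W| * #|[pred u | unc Z u && r z u]| <= d * #|U|)%N.
  have [zZ|zZ] := boolP (z \in Z).
    rewrite (eq_card0 (A := [pred u | unc Z u && r z u])) ?muln0// => u.
    rewrite !inE; apply/negbTE/negP => /andP[/negP nc rz]; apply: nc.
    by apply/existsP; exists z; rewrite zZ.
  have := Zmax (finset.setU (finset.set1 z) Z) isT; rewrite /Phi.
  have := ZC (finset.setU (finset.set1 z) Z); rewrite finset.cardsU1 zZ.
  have -> : (#|cov (finset.setU (finset.set1 z) Z)| =
      #|cov Z| + #|[pred u | unc Z u && r z u]|)%N.
    rewrite -[LHS](cardID (cov Z)); congr (_ + _)%N.
      apply: eq_card => u; rewrite !inE.
      apply/andP/idP => [[]//|c]; split => //.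
      apply/existsP; case/existsP: c => w /andP[wZ rw]; exists w.
      by rewrite finset.in_setU wZ orbT rw.
    apply: eq_card => u; rewrite !inE; case: (boolP [exists w in Z, r w u]) => //= nc.
    apply/existsP/idP => [[w]|rz]; last by exists z; rewrite finset.in_setU finset.in_set1 eqxx.
    rewrite finset.in_setU finset.in_set1 => /andP[/orP[/eqP -> //|wZ] rw].
    by case/negP: nc; apply/existsP; exists w; rewrite wZ.
  have := ZC Z; nia.
have tot : (d * #|unc Z| <= \sum_(z : W) #|[pred u | unc Z u && r z u]|)%N.
  rewrite (eq_bigr (fun z => \sum_(u | unc Z u) r z u)%N); last first.
    by move=> z _; rewrite -sum1_card big_mkcondr /=; apply: eq_bigr => u _; case: (r z u).
  rewrite exchange_big /= mulnC -sum_nat_const; apply: leq_sum => u _.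
  apply: leq_trans (rd u) _; rewrite -sum1_card big_mkcond /=.
  by apply: leq_sum => w _; rewrite inE; case: (r w u).
have tot2 : (2 * #|W| * \sum_(z : W) #|[pred u | unc Z u && r z u]| <= #|W| * (d * #|U|))%N.
  by rewrite big_distrr /= -sum_nat_const; apply: leq_sum.
have W0 : (0 < #|W|)%N.
  have /card_gt0P[u _] := Upos; apply: leq_trans d0 (leq_trans (rd u) (max_card _)).
have dW : (0 < d * #|W|)%N by rewrite muln_gt0 d0.
rewrite -/(unc Z) -(leq_pmul2l dW); nia.
Qed.

Section grid.
Variables (R : realType) (n : nat).
Local Notation V := 'rV[R]_n.

Definition cell (N : nat) (d : R) (k : {ffun 'I_n -> 'I_N}) : set V :=
  hcube (d *: gridpt R k)%R d.

Lemma grid_cover (N : nat) (d : R) (x : V) : (0 < d)%R ->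
  hcube 0 (d * N%:R)%R x -> exists k : {ffun 'I_n -> 'I_N}, cell d k x.
Proof.
move=> d0 xN.
(* Cells are open on the lower side, so the integer part is taken of the distance to the upper face,
   and the index is reversed. *)
have ur i : (0 <= N%:R - x ord0 i / d < N%:R)%R.
  have := xN i; rewrite mxE add0r => /andP[? ?].
  by rewrite subr_ge0 ler_pdivrMr// mulrC ltrBlDr ltrDl divr_gt0// andbT.
have kN i : (Num.truncn (N%:R - x ord0 i / d) < N)%N.
  by have /andP[u0 uN] := ur i; rewrite truncn_lt_nat.
exists [ffun i => rev_ord (Ordinal (kN i))] => i.
rewrite !mxE !ffunE /= natrB ?kN//.
have /andP[/truncn_itv /andP[]] := ur i.
move: (Num.truncn _) => j; rewrite -natr1 => h1 h2 _.
have {}h1 : (x ord0 i / d <= N%:R - j%:R)%R by lra.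
have {}h2 : (N%:R - (j%:R + 1) < x ord0 i / d)%R by lra.
rewrite ler_pdivrMr// in h1; rewrite ltr_pdivlMr// in h2.
by apply/andP; split; lra.
Qed.

(** Subadditivity is enough: the whole grid has the measure of N^n cells, and the cells outside [P]
    cover at most the measure of their number. *)
Lemma leb_cells_ge (N : nat) (d : R) (P : pred {ffun 'I_n -> 'I_N}) : (0 < d)%R -> (0 < n)%N ->
  (#|P|%:R * (d ^+ n * kappa R n))%:E <= leb [set x | exists2 k, P k & cell d k x].
Proof.
move=> d0 n0; set S := [set x | _].
have [N0|Npos] := posnP N.
  rewrite (_ : #|P| = 0%N) ?mul0r ?leb_ge0//; apply/eqP; rewrite -leqn0.
  by apply: leq_trans (max_card _) _; rewrite card_ffun !card_ord N0 exp0n.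
have dN0 : (0 < d * N%:R)%R by rewrite mulr_gt0// ltr0n.
have h : leb (hcube (0 : V) (d * N%:R)%R) <=
    leb S + #|finset (predC P)|%:R%:E * (d ^+ n * kappa R n)%:E.
  apply: (@le_trans _ _ (leb (S `|` [set x | exists2 k, k \in finset (predC P) & cell d k x]))).
    apply: le_leb => x /(grid_cover d0)[k kx].
    have [Pk|Pk] := boolP (P k); first by left; exists k.
    by right; exists k => //; rewrite inE.
  apply: le_trans (lebU _ _) _; apply: leeD => //.
  apply: (leb_cover (F := cell d)) => // [|k _]; last by rewrite leb_hcube.
  have := leb_ge0 (hcube (0 : V) d); by rewrite leb_hcube.
rewrite leb_hcube// exprMn -natrX in h.
have cN : (N ^ n = #|P| + #|finset (predC P)|)%N.
  by rewrite finset.cardsE (cardC P) card_ffun !card_ord.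
rewrite cN natrD in h.
rewrite -(leeD2rE _ _ (x := (#|finset (predC P)|%:R * (d ^+ n * kappa R n))%:E))//.
apply: le_trans h; rewrite -EFinD lee_fin; lra.
Qed.

Lemma eucl_diam_le (Q : set V) (x : V) (s : R) : (0 <= s)%R ->
  (forall y : V, Q y -> forall i, (`|y ord0 i - x ord0 i| <= s)%R) ->
  eucl_diam Q <= (n%:R * (2 * s))%:E.
Proof.
move=> s0 Qs; apply: ge_ereal_sup => _ [y Qy [z Qz <-]]; rewrite lee_fin /eucl_dist.
have ns : (0 <= n%:R * (2 * s))%R by rewrite !mulr_ge0.
rewrite -(ger0_norm ns) -sqrtr_sqr; apply: ler_wsqrtr.
apply: (@le_trans _ _ (\sum_(i < n) (2 * s) ^+ 2)%R).
  apply: ler_sum => i _; rewrite -real_normK ?num_real//.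
  apply: lerXn2r; rewrite ?nnegrE ?mulr_ge0//.
  have := Qs _ Qy i; have := Qs _ Qz i; rewrite !ler_norml => /andP[? ?] /andP[? ?].
  by apply/andP; split; lra.
rewrite sumr_const card_ord -[X in (X <= _)%R]mulr_natl (exprMn _ n%:R)%R.
apply: ler_wpM2r; first exact: sqr_ge0.
(* The factor n in place of its square root makes the bound free of roots, as n <= n^2. *)
by rewrite -natrX ler_nat -mulnn; nia.
Qed.

Lemma average_indic (E Q : set V) : lmeasurable E -> lmeasurable Q ->
  average (fun y => `|\1_E y|)%R Q = leb (E `&` Q) / leb Q.
Proof.
move=> mE mQ; rewrite /average; congr (_ / _).
rewrite -[RHS](@integral_indic _ (lebesgue_space R n) R (@leb R n) Q mQ E mE).
by apply: eq_integral => y _; rewrite ger0_norm.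
Qed.

End grid.

Lemma ltn_addB_double (u K i : nat) : (u < K)%N -> (u + K - i < 2 * K)%N.
Proof. lia. Qed.

Lemma leq_double_half (a b c : nat) : (2 * b <= c)%N -> (a + b = c)%N -> (c <= 2 * a)%N.
Proof. lia. Qed.

(** * Consequences of irregularity: large halo function and bad sets *)

Section irregular_consequences.
Variables (R : realType) (n : nat).
Hypothesis n0 : (0 < n)%N.
Local Notation V := 'rV[R]_n.
Variable B : V -> set (set V).
Hypotheses (Bb : is_basis B) (Bh : homothecy_invariant B) (Bc : convex_basis B).

Lemma kappa_le1 : (kappa R n <= 1)%R.
Proof.
have E : leb (hcube (0 : V) 1%R) = (kappa R n)%:E by rewrite leb_hcube// expr1n mul1r.
rewrite -lee_fin -E hcubeE; apply: le_trans (leb_box_le _) _; rewrite lee_fin /=.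
by rewrite big1// => i _; rewrite !mxE add0r subr0 max_r.
Qed.

(** The test set is the small cube of [irregular_cells], of measure [ep]: on all cells of [I], which
    fill at least m 2^-(n+1), its mean over a set of measure 1 is [ep]. With m 2^-(n+1) > c this
    beats the bound at [t = ep^-1]. *)
Lemma halo_linear_regular (c : R) :
  (forall t : R, (1 <= t)%R -> halo B t <= (c * t)%:E) -> regular_basis B.
Proof.
move=> hc; apply: contrapT => irr.
have e0 : (0 < 2^-1 ^+ n.+1 :> R)%R by rewrite exprn_gt0.
have [m _ mc] := exists_nat_gt (c / 2^-1 ^+ n.+1)%R.
rewrite ltr_pdivrMr// in mc.
have [d [L [N [e [I [/andP[d0 d1] L0 mI HI]]]]]] := irregular_cells n0 Bb Bh Bc irr m.
have k0 := kappa_gt0 Bb.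
set ep := (d ^+ n * kappa R n)%R in mI.
have ep0 : (0 < ep)%R by rewrite mulr_gt0// exprn_gt0.
have ep1 : (ep < 1)%R.
  apply: (@le_lt_trans _ _ (d ^+ n)%R); last by rewrite exprn_ilt1 ?(ltW d0)// -lt0n.
  by rewrite -[leRHS]mulr1 ler_pM2l ?exprn_gt0// kappa_le1.
have bE : bounded_lmeasurable (hcube e d).
  have [r r0 er] := hcube_inbox e d.
  by split; [exact: inbox_bounded er|exact: lmeasurable_hcube].
have lE : leb (hcube e d) = ep%:E by rewrite leb_hcube.
have t1 : (1 < ep^-1)%R by rewrite invf_gt1.
have := hc (ep^-1)%R (ltW t1); rewrite /halo; case: ifPn => [|_]; first by rewrite leNgt t1.
apply/negP; rewrite -ltNge.
set S := [set x | exists2 k, k \in I & cell d k x].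
have cSI : #|I|%:R%:E * ep%:E <= leb S.
  by rewrite -EFinM; exact: (leb_cells_ge (fun k => k \in I) d0 n0).
apply: (@lt_le_trans _ _ (leb S / leb (hcube e d))).
  rewrite lE inver gt_eqF// lte_pdivlMr// -EFinM divfK ?gt_eqF//.
  by apply: lt_le_trans cSI; rewrite -EFinM lte_fin; exact: lt_le_trans mI.
apply: (@le_trans _ _ (leb [set x | ((ep^-1)^-1)%R%:E <= maximal_operator B (\1_(hcube e d)) x]
    / leb (hcube e d))); last first.
  by apply: ereal_sup_ubound; exists (hcube e d) => //; split => //; rewrite lE.
rewrite lE; apply: lee_wpmul2r; first by rewrite inve_ge0 lee_fin ltW.
apply: le_leb => x [k kI kx] /=; rewrite invrK.
have [Q [xQ Q1 EQ _]] := HI k x kI kx.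
have [[_ mQ] _ _] := basis_prop Bb xQ.
apply: ereal_sup_ge; exists (average (fun y => `|\1_(hcube e d) y|)%R Q); first by exists Q.
by rewrite average_indic// ?(setIidl EQ) ?lE ?Q1 ?inve1 ?mule1//; exact: lmeasurable_hcube.
Qed.

(** [F] consists of small copies of the cube of [irregular_cells], [G] of the grid cells where one
    of them yields a large mean. The greedy choice of the copies covers half of the unit cube at a
    cost inversely proportional to [m]. *)
Lemma irregular_bad_set (c ep eta : R) : ~ regular_basis B ->
  (0 < c)%R -> (0 < ep)%R -> (0 < eta)%R ->
  exists (H : R) (F G : set V), [/\ (0 < H)%R, lmeasurable F, H%:E * leb F <= ep%:E,
    [/\ lmeasurable G, G `<=` hcube 0 1 & (kappa R n / 2)%:E <= leb G] &
    forall x, G x -> exists Q,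
      [/\ B x Q, eucl_diam Q < eta%:E & c%:E * leb Q <= H%:E * leb (F `&` Q)]].
Proof.
move=> irr c0 ep0 eta0.
have k0 := kappa_gt0 Bb.
have e0 : (0 < 2^-1 ^+ n.+1 :> R)%R by rewrite exprn_gt0.
(* The integral will be at most 2 * 2^n * c * kappa / (|I| dk), and |I| dk is at least m
   2^-(n+1). *)
have [m m0 mc] := exists_nat_gt (2 * 2 ^+ n * c * kappa R n / ep / 2^-1 ^+ n.+1)%R.
rewrite ltr_pdivrMr// ltr_pdivrMr// in mc.
have [d [L [N [e [I [/andP[d0 d1] L0 mI HI]]]]]] := irregular_cells n0 Bb Bh Bc irr m.
set dk := (d ^+ n * kappa R n)%R in mI.
have dk0 : (0 < dk)%R by rewrite mulr_gt0// exprn_gt0.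
have I0 : (0 < #|I|)%N.
  rewrite lt0n; apply/negP => /eqP I0; move: mI; rewrite I0 mul0r leNgt.
  by rewrite mulr_gt0// ltr0n.
(* Scaling by [h = (K d)^-1] turns cells of side [d] into grid cells of side 1/K. A large [K] brings
   the diameters below [eta] and gives [N <= K]. *)
have [K K0 KN] := exists_nat_gt (N%:R + n%:R * (2 * L) / (d * eta))%R.
have KR0 : (0 < K%:R :> R)%R by rewrite ltr0n.
have nL0 : (0 <= n%:R * (2 * L) / (d * eta))%R.
  by rewrite divr_ge0 ?mulr_ge0 ?(ltW d0) ?(ltW eta0)//; lra.
have NK : (N <= K)%N by rewrite -(ler_nat R) ltW//; apply: le_lt_trans KN; rewrite lerDl.
pose h := (K%:R * d)^-1%R.
have h0 : (0 < h)%R by rewrite invr_gt0 mulr_gt0.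
have hd : (h * d = K%:R^-1)%R by rewrite /h invfM mulfVK ?gt_eqF.
have hL : (n%:R * (2 * (h * L)) < eta)%R.
  have E : (n%:R * (2 * L) / (d * eta) < K%:R)%R.
    by apply: le_lt_trans KN; rewrite lerDr.
  rewrite ltr_pdivrMr ?mulr_gt0// in E.
  rewrite (_ : n%:R * (2 * (h * L)) = n%:R * (2 * L) / (K%:R * d))%R.
    rewrite ltr_pdivrMr ?mulr_gt0//; lra.
  by rewrite /h; field; rewrite !gt_eqF.
pose W := {ffun 'I_n -> 'I_(2 * K)}; pose U := {ffun 'I_n -> 'I_K}.
(* The copy with index [w] is translated by [w - K] grid steps, and [u] is one of its good cells
   [i]. The offset [K] keeps all indices nonnegative, whence the range 2 K for [w]. *)
pose r (w : W) (u : U) := [exists i in I, [forall j, (u j + K == w j + i j)%N]].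
(* Different cells [i] bring different translations [w = u + K - i] to the same [u]. *)
have rI u : (#|I| <= #|[pred w | r w u]|)%N.
  have lt (i : {ffun 'I_n -> 'I_N}) j : (u j + K - i j < 2 * K)%N.
    exact: ltn_addB_double.
  pose g (i : {ffun 'I_n -> 'I_N}) : W := [ffun j => Ordinal (lt i j)].
  have leiK (i : {ffun 'I_n -> 'I_N}) j : (i j <= u j + K)%N.
    by apply: leq_trans (leq_trans (ltnW (ltn_ord (i j))) NK) (leq_addl _ _).
  rewrite -(@card_imset _ _ g); last first.
    move=> i i' gi; apply/ffunP => j; apply: val_inj; have := congr1 (fun w : W => val (w j)) gi.
    by rewrite !ffunE /= => /(congr1 (subn (u j + K))); rewrite !subKn.
  apply: subset_leq_card; apply/fintype.subsetP => w /imsetP[i iI ->]; rewrite inE.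
  apply/existsP; exists i; rewrite iI; apply/forallP => j; rewrite !ffunE /=.
  by rewrite subnK.
have [Z [ZI Zunc]] := greedy_cover I0 rI.
pose a (w : W) : V := (K%:R^-1 *: (gridpt R w - const_mx K%:R))%R.
pose E := hcube e d.
pose F := [set x | exists2 w, w \in Z & (aff (a w) h @` E) x].
pose P := [pred u | [exists w in Z, r w u]].
pose G : set V := [set x : V | exists2 u, P u & cell (K%:R^-1 : R)%R u x].
have lE : leb E = dk%:E by rewrite leb_hcube.
have mE : lmeasurable E by exact: lmeasurable_hcube.
have fin_meas (T : finType) (PT : pred T) (f : T -> set V) :
    (forall k, lmeasurable (f k)) -> lmeasurable [set x | exists2 k, PT k & f k x].
  move=> mf; rewrite (_ : [set x | _] = \bigcup_(k in [set k | PT k]) f k)//.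
  by apply: (@fin_bigcup_measurable _ (lebesgue_space R n)) => [|k _]; [exact: finite_finset|exact: mf].
have mF : lmeasurable F by apply: fin_meas => w; exact: lmeasurable_aff.
have Ki0 : (0 < K%:R^-1 :> R)%R by rewrite invr_gt0.
have ZIR : (#|Z|%:R * #|I|%:R <= 2 * 2 ^+ n * K%:R ^+ n :> R)%R.
  rewrite -!natrX -!natrM ler_nat; move: ZI.
  by rewrite card_ffun !card_ord expnMn mulnA.
exists (c / dk)%R, F, G; split => //.
- by rewrite divr_gt0.
- apply: (@le_trans _ _ ((c / dk)%:E * (#|Z|%:R%:E * (h ^+ n * dk)%:E))).
    apply: lee_wpmul2l; first by rewrite lee_fin divr_ge0// ltW.
    apply: (leb_cover (F := fun w => aff (a w) h @` E)) => [|//|w _].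
      by rewrite lee_fin mulr_ge0 ?exprn_ge0 ?(ltW h0) ?(ltW dk0).
    by rewrite leb_aff// lE.
  rewrite -!EFinM lee_fin.
  have IR0 : (0 < #|I|%:R :> R)%R by rewrite ltr0n.
  have hn : (h ^+ n * (K%:R ^+ n * d ^+ n) = 1)%R.
    by rewrite -exprMn -exprMn mulVf ?expr1n// gt_eqF// mulr_gt0.
  have hn0 : (0 < h ^+ n)%R by rewrite exprn_gt0.
  have dn0 : (0 < d ^+ n)%R by rewrite exprn_gt0.
  have -> : (c / dk * (#|Z|%:R * (h ^+ n * dk)) = c * #|Z|%:R * h ^+ n)%R.
    have gen (p q z x : R) : (q != 0 -> p / q * (z * (x * q)) = p * z * x)%R.
      by move=> q0; field.
    by rewrite gen// gt_eqF.
  rewrite -(ler_pM2r (mulr_gt0 IR0 dk0)).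
  apply: (@le_trans _ _ (2 * 2 ^+ n * c * kappa R n)%R).
    rewrite (_ : 2 * 2 ^+ n * c * kappa R n =
        c * (2 * 2 ^+ n * K%:R ^+ n) * h ^+ n * d ^+ n * kappa R n)%R; last first.
      transitivity (2 * 2 ^+ n * c * kappa R n * (h ^+ n * (K%:R ^+ n * d ^+ n)))%R; last by ring.
      by rewrite hn mulr1.
    rewrite (_ : c * #|Z|%:R * h ^+ n * (#|I|%:R * dk) =
      c * (#|Z|%:R * #|I|%:R) * h ^+ n * d ^+ n * kappa R n)%R; last by rewrite /dk; ring.
    by rewrite !ler_pM2r// ler_pM2l.
  by apply: (le_trans (ltW mc)); rewrite [X in (X <= _)%R]mulrC ler_pM2l.
- split.
  + by apply: fin_meas => u; exact: lmeasurable_hcube.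
  + move=> x [u _ ux] i; have := ux i; rewrite !mxE add0r => /andP[ux1 ux2].
    have uK : ((u i)%:R + 1 <= K%:R :> R)%R by rewrite natr1 ler_nat.
    rewrite (le_lt_trans _ ux1) ?mulr_ge0 ?(ltW Ki0)//=; apply: (le_trans ux2).
    by rewrite -[X in (_ + X <= _)%R]mulr1 -mulrDr mulrC ler_pdivrMr// mul1r.
  + apply: le_trans (leb_cells_ge P Ki0 n0); rewrite lee_fin.
    have PC : (K ^ n <= 2 * #|P|)%N.
      have := cardC P; have := Zunc; rewrite card_ffun !card_ord => h1 h2.
      have h3 : #|[predC P]| = #|[pred u : U | ~~ [exists w in Z, r w u]]|.
        by apply: eq_card => u; rewrite !inE.
      by rewrite h3 in h2; exact: leq_double_half h1 h2.
    have {}PC : (K%:R ^+ n <= 2 * #|P|%:R :> R)%R by rewrite -natrX -natrM ler_nat.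
    have Kn0 : (0 < K%:R ^+ n :> R)%R by rewrite exprn_gt0.
    rewrite exprVn mulrA [X in (_ <= X)%R]mulrC ler_pM2l// ler_pdivlMr//; lra.
move=> x [u /existsP[w /andP[wZ /existsP[i /andP[iI /forallP wi]]]] ux].
(* Undoing the scaling puts [x] into a good cell [i]; the image of the set found there contains the
   copy of [E] with index [w]. *)
pose y := aff (affV (a w) h) h^-1%R x.
have xy : x = aff (a w) h y by rewrite affVK.
clearbody y.
have yi : cell d i y.
  move=> j; have := ux j; rewrite {1 2}xy affE !mxE.
  have : ((u j)%:R = (w j)%:R + (i j)%:R - K%:R :> R)%R.
    by rewrite -natrD -(eqP (wi j)) natrD addrK.
  move=> -> /andP[A1 A2].
  have A3 : (K%:R^-1 * (i j)%:R = h * (d * (i j)%:R))%R by rewrite -hd -mulrA.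
  rewrite -(ltr_pM2l h0) -(ler_pM2l h0) (mulrDr h) hd -A3.
  by apply/andP; split; lra.
have [Q [yQ Q1 EQ QL]] := HI i y iI yi.
have [[_ mQ] _ _] := basis_prop Bb yQ.
exists (aff (a w) h @` Q); split.
- by rewrite xy; exact: basis_aff.
- apply: le_lt_trans (@eucl_diam_le R n _ x (h * L)%R _ _) _.
  + by rewrite mulr_ge0 ?(ltW h0) ?(ltW L0).
  + move=> _ [q Qq <-] j; rewrite xy !affE opprD addrACA subrr add0r -mulrBr.
    by rewrite normrM (gtr0_norm h0) ler_pM2l//; exact: QL.
  + by rewrite lte_fin.
rewrite leb_aff// Q1 mule1.
apply: (@le_trans _ _ ((c / dk)%:E * leb (aff (a w) h @` E))).
  have gen (p q z : R) : (q != 0 -> p / q * (z * q) = p * z)%R by move=> q0; field.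
  by rewrite leb_aff// lE -!EFinM lee_fin gen ?gt_eqF.
apply: lee_wpmul2l; first by rewrite lee_fin divr_ge0// ltW.
apply: le_leb => _ [z Ez <-]; split; first by exists w => //; exists z.
by exists z => //; exact: EQ.
Qed.

End irregular_consequences.

(** * Failure of differentiation *)

Section no_differentiation.
Variables (R : realType) (n : nat).
Hypothesis n0 : (0 < n)%N.
Local Notation V := 'rV[R]_n.
Local Notation T := (lebesgue_space R n).
Local Notation mu := (@leb R n).
Variable B : V -> set (set V).
Hypotheses (Bb : is_basis B) (Bh : homothecy_invariant B) (Bc : convex_basis B).

(** The tail unions decrease inside a set of finite measure, so continuity from above applies. *)
Lemma lim_sup_set_leb_ge (G : nat -> set V) (X : set V) (k : R) :
  (forall j, [/\ lmeasurable (G j), G j `<=` X & k%:E <= leb (G j)]) -> leb X < +oo ->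
  k%:E <= leb (\bigcap_i \bigcup_(j in [set j | (i <= j)%N]) G j).
Proof.
move=> HG Xoo; pose F i := \bigcup_(j in [set j | (i <= j)%N]) G j.
have mF i : measurable (F i : set T).
  by apply: bigcup_measurable => j _; have [] := HG j.
have FX i : F i `<=` X by move=> x [j _ Gx]; have [_ + _] := HG j; apply.
have cF : mu (F i) @[i --> \oo] --> mu (\bigcap_i F i).
  apply: (@nonincreasing_cvg_mu _ T R mu F) => //.
  - exact: le_lt_trans (le_leb (FX 0%N)) Xoo.
  - exact: bigcap_measurable.
  - move=> i j ij; apply/subsetPset => x [l /= jl Gx]; exists l => //=.
    exact: leq_trans jl.
rewrite -/(mu _) -(cvg_lim _ cF)//; apply: lime_ge; first by apply/cvg_ex; exists (mu (\bigcap_i F i)).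
apply: nearW => i; have [_ _ kG] := HG i; apply: (le_trans kG).
by apply: le_leb => x Gx; exists i => //=.
Qed.

Lemma integral_scaled_indic (H : R) (F D : set V) : (0 <= H)%R ->
  lmeasurable F -> lmeasurable D ->
  \int[mu]_(x in D) (H * \1_F x)%:E = H%:E * leb (F `&` D).
Proof.
move=> H0 mF mD.
rewrite -[X in _ = _ * X](@integral_indic _ T R mu D mD F mF).
rewrite -ge0_integralZl_EFin//.
by apply/measurable_EFinP; exact: measurable_indic.
Qed.

Lemma upper_derivative_gt (f : V -> R) (x : V) (l : R) :
  (forall j : nat, exists Q, [/\ B x Q, eucl_diam Q < (j.+1%:R^-1)%:E &
     j.+1%:R%:E <= average f Q]) ->
  upper_derivative B f x <> l%:E.
Proof.
move=> H E.
have /ereal_inf_lt[_ [d /= d0 <-] dl] : upper_derivative B f x < (l + 1)%:E.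
  by rewrite E lte_fin ltrDl.
have [N N0 NN] := exists_nat_gt (`|l + 1| + d^-1)%R.
have Nl : (l + 1 <= N%:R)%R.
  apply/ltW; apply: le_lt_trans NN; apply: (le_trans (ler_norm _)).
  by rewrite lerDl invr_ge0 ltW.
have Nd : (d^-1 < N%:R)%R by apply: le_lt_trans NN; rewrite lerDr.
have [Q [xQ dQ aQ]] := H N.
move: dl; apply/negP; rewrite -leNgt.
apply: (@le_trans _ _ (N.+1%:R)%:E).
  by rewrite lee_fin (le_trans Nl)// ler_nat.
apply: (le_trans aQ); apply: ereal_sup_ubound; exists Q => //; split => //.
apply: (lt_trans dQ); rewrite lte_fin invf_plt ?posrE ?ltr0n//.
by apply: (lt_trans Nd); rewrite ltr_nat.
Qed.

(** The sum of the functions [h j] is integrable, while at every point lying in infinitely many of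
    the bad sets its means over small sets are unbounded. These points have measure at least
    [kappa / 2]. *)
Lemma differentiates_regular :
  differentiates_class B (@lebesgue_integrable R n) -> regular_basis B.
Proof.
move=> diff; apply: contrapT => irr.
have k0 := kappa_gt0 Bb.
have /choice[HFG bad] : forall j : nat, exists t : R * set V * set V,
  [/\ (0 < t.1.1)%R, lmeasurable t.1.2,
      t.1.1%:E * leb t.1.2 <= (1 / (2 ^ j.+1)%:R)%:E,
    [/\ lmeasurable t.2, t.2 `<=` hcube 0 1 & (kappa R n / 2)%:E <= leb t.2] &
    forall x, t.2 x -> exists Q, [/\ B x Q, eucl_diam Q < (j.+1%:R^-1)%:E &
       j.+1%:R%:E * leb Q <= t.1.1%:E * leb (t.1.2 `&` Q)]].
  move=> j; have [|||H [F [G HP]]] := @irregular_bad_set R n n0 B Bb Bh Bc j.+1%:R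
      (1 / (2 ^ j.+1)%:R)%R (j.+1%:R^-1)%R irr.
  - by [].
  - by rewrite divr_gt0// ltr0n expn_gt0.
  - by rewrite invr_gt0.
  by exists (H, F, G).
pose h j (x : V) : \bar R := ((HFG j).1.1 * \1_((HFG j).1.2) x)%:E.
have h0 j x : 0 <= h j x.
  have [Hj _ _ _ _] := bad j; by rewrite lee_fin mulr_ge0// ltW.
have mh j (D : set V) : measurable_fun (D : set T) (h j : T -> \bar R).
  have [_ mF _ _ _] := bad j; apply/measurable_EFinP.
  by apply: measurable_funM => //; exact: measurable_indic.
pose f0 (x : V) := \sum_(j <oo) h j x.
have f00 x : 0 <= f0 x by exact: nneseries_ge0.
have mf0 (D : set V) : measurable_fun (D : set T) (f0 : T -> \bar R).
  by apply: ge0_emeasurable_sum => // j x _ _; exact: h0.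
have if0 : mu.-integrable setT (f0 : T -> \bar R).
  apply/integrableP; split; first exact: mf0.
  under eq_integral => x _ do rewrite gee0_abs//.
  rewrite integral_nneseries//.
  apply: (@le_lt_trans _ _ 1%:E); last by rewrite ltry.
  apply: le_trans (epsilon_trick0 xpredT ler01).
  apply: lee_nneseries => [j _ _|j _]; first exact: integral_ge0.
  have [Hj mF le1 _ _] := bad j.
  have mT : lmeasurable (setT : set V) := @measurableT _ T.
  by rewrite /h (integral_scaled_indic (ltW Hj) mF mT) setIT.
(* [fine] sends the value [+oo] to 0; the sum being integrable, this happens only on a null set. *)
pose f (x : V) : R := fine (f0 x).
have mf (D : set V) : measurable_fun (D : set T) (EFin \o f : T -> \bar R).
  apply/measurable_EFinP; apply: (measurableT_comp (fine_measurable _)) => //.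
have if_ : lebesgue_integrable f.
  apply: (@le_integrable _ T R mu setT _ _ f0) => // x _.
  rewrite /f; case: (f0 x) => [r| |] //=; rewrite ?normr0 ?leey//.
have ff0 (D : set V) : lmeasurable D -> \int[mu]_(x in D) (f x)%:E = \int[mu]_(x in D) f0 x.
  move=> mD; apply: (@ae_eq_integral _ T R mu D) => //.
  have := @integrable_ae _ T R mu setT measurableT _ if0.
  by apply: filterS => x + _; move=> /(_ I) fx; rewrite /f fineK.
have [N [mN N0 bN]] := diff f if_.
suff /(le_trans (lim_sup_set_leb_ge (G := fun j => (HFG j).2) (X := hcube 0 1) (k := kappa R n / 2) _ _)) :
    leb (\bigcap_i \bigcup_(j in [set j | (i <= j)%N]) (HFG j).2) <= 0.
  rewrite lee_fin leNgt divr_gt0//= => H; apply: notF; apply: H.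
    by move=> j; have [] := bad j.
  by rewrite leb_hcube ?ltry.
(* The limsup of the bad sets lies in the exceptional null set. *)
rewrite -N0; apply: le_leb => x Gx; apply: bN => -[+ _].
apply: upper_derivative_gt => j; have [i /= ji Gi] := Gx j I.
have [Hi mF _ _ GQ] := bad i; have [Q [xQ dQ aQ]] := GQ x Gi.
have ij : (j.+1%:R <= i.+1%:R :> R)%R by rewrite ler_nat.
have [[_ mQ] _ _] := basis_prop Bb xQ.
have [q q0 Qq] := basis_leb Bb xQ.
exists Q; split => //.
  by apply: (lt_le_trans dQ); rewrite lee_fin lef_pV2 ?posrE.
rewrite /average ff0// Qq inver gt_eqF// lee_pdivlMr//.
apply: (@le_trans _ _ (i.+1%:R%:E * leb Q)).
  by rewrite Qq -!EFinM lee_fin ler_pM2r.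
apply: (le_trans aQ); rewrite -integral_scaled_indic ?(ltW Hi)//.
apply: ge0_le_integral => [//|y _| | |y _]; [exact: (h0 i)|exact: (mh i)|exact: mf0|].
rewrite /f0 (@nneseriesD1 _ _ i)//; rewrite leeDl//.
by apply: nneseries_ge0.
Qed.

End no_differentiation.

(** * Vitali covering and the weak type inequality *)

Section vitali_cubes.
Variables (R : realType) (n : nat).
Local Notation V := 'rV[R]_n.

Lemma cube_absorb (a b x : V) (s t : R) : (s <= 2 * t)%R -> cube a s x -> cube b t x ->
  cube a s `<=` cube (b - const_mx (2 * t))%R (5 * t)%R.
Proof.
move=> st ax bx y ay i; have := ax i; have := bx i; have := ay i; rewrite !mxE.
by move=> /andP[? ?] /andP[? ?] /andP[? ?]; apply/andP; split; lra.
Qed.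

(** As an affine image, the enlargement has 5^n times the measure of the closed cube, which itself
    is never computed. *)
Lemma cube5E (a : V) (t : R) :
  cube (a - const_mx (2 * t))%R (5 * t)%R = aff ((-4)%R *: a - const_mx (2 * t))%R 5 @` cube a t.
Proof.
rewrite aff_cube//; congr cube; apply/rowP => i; rewrite !mxE; lra.
Qed.

Variables (I : Type) (D : set I) (a : I -> V) (s : I -> R) (M : R).
Hypothesis sM : forall i, D i -> (0 < s i <= M)%R.
(** Stands for a bound on the total measure: it rules out infinitely many disjoint cubes with sides
    bounded below. *)
Hypothesis fin : forall (eta : R) (t : nat -> I), (0 < eta)%R ->
  (forall k, D (t k) /\ (eta <= s (t k))%R) ->
  (forall j k, (j < k)%N -> cube (a (t j)) (s (t j)) `&` cube (a (t k)) (s (t k)) = set0) ->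
  False.

Let Q i := cube (a i) (s i).
Let cand (l : list I) (i : I) := D i /\ forall j, List.In j l -> Q i `&` Q j = set0.

(* Admissible cubes are those disjoint from the ones chosen before; the next cube
   has at least half the supremum of their sides. *)
Let pick_spec (l : list I) (o : option I) :=
  if o is Some i then cand l i /\ forall j, cand l j -> (s j <= 2 * s i)%R
  else forall i, ~ cand l i.

Let pick_ex l : exists o, pick_spec l o.
Proof.
have [[i0 ci0]|nc] := pselect (exists i, cand l i); last first.
  by exists None => i ci; apply: nc; exists i.
pose S := [set s i | i in cand l].
have Ss : has_sup S.
  split; first by exists (s i0); exists i0.
  by exists M => _ [i [Di _] <-]; have /andP[] := sM Di.
have s0 : (0 < sup S)%R.
  have /andP[si0 _] := sM ci0.1; apply: (lt_le_trans si0).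
  by apply: ub_le_sup; [exact: Ss.2|exists i0].
have [|_ [i ci <-] hi] := @sup_adherent _ S (sup S / 2)%R _ Ss; first by rewrite divr_gt0.
exists (Some i); split => // j cj.
have : (s j <= sup S)%R by apply: ub_le_sup; [exact: Ss.2|exists j].
lra.
Qed.

(** A cube admissible forever would force infinitely many disjoint choices of at least half its
    side, against [fin]. So at some stage it meets the newly chosen cube, whose enlargement absorbs
    it. The value [None] marks stages without a choice. *)
Lemma vitali_greedy : exists o : nat -> option I,
  [/\ forall k i, o k = Some i -> D i,
    forall j k i i', (j < k)%N -> o j = Some i -> o k = Some i' -> Q i `&` Q i' = set0 &
    forall i, D i -> exists k j, o k = Some j /\
       Q i `<=` cube (a j - const_mx (2 * s j))%R (5 * s j)%R].
Proof.
have [pick pickP] := choice pick_ex.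
pose L := fix L k := if k is k'.+1 then
  (if pick (L k') is Some i then i :: L k' else L k') else [::].
have LS k : L k.+1 = if pick (L k) is Some i then i :: L k else L k by [].
have LP k : pick_spec (L k) (pick (L k)) by [].
have Lmono j k i : (j < k)%N -> pick (L j) = Some i -> List.In i (L k).
  move=> + pj; elim: k => // k IH; rewrite ltnS leq_eqVlt => /orP[/eqP jk|/IH iL].
    by rewrite LS -jk pj; left.
  by rewrite LS; case: (pick (L k)) => // i'; right.
exists (fun k => pick (L k)); split.
- by move=> k i ki; have := LP k; rewrite ki => -[[]].
- move=> j k i i' jk ji ki'; rewrite setIC; have := LP k; rewrite ki' => -[[_ +] _].
  by apply; exact: Lmono jk ji.
move=> i Di.
have [k [ck nck]] : exists k, cand (L k) i /\ ~ cand (L k.+1) i.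
  apply: contrapT => H.
  have call k : cand (L k) i.
    elim: k => [|k IH]; first by split.
    by apply: contrapT => nc; apply: H; exists k.
  have /choice[t tP] : forall k, exists j, pick (L k) = Some j.
    move=> k; have := LP k; case: (pick (L k)) => [j _|/(_ i (call k))//].
    by exists j.
  apply: (@fin (s i / 2)%R t) => [|k|j k jk].
  - by have /andP[? _] := sM Di; rewrite divr_gt0.
  - have := LP k; rewrite tP => -[[Dk _] /(_ i (call k)) ?]; split => //; lra.
  - rewrite setIC; have := LP k; rewrite tP => -[[_ +] _]; apply.
    exact: Lmono jk (tP j).
have := LP k; rewrite LS in nck; case E : (pick (L k)) nck => [j|//] nck [cj /(_ i ck) sij].
exists k, j; split => //.
have : ~ (Q i `&` Q j = set0).
  move=> Qij; apply: nck; split => // j' [<-//|]; exact: ck.2.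
move/eqP/set0P => [x [ix jx]]; exact: cube_absorb sij ix jx.
Qed.

End vitali_cubes.

Section weak_type.
Variables (R : realType) (n : nat).
Hypothesis n0 : (0 < n)%N.
Local Notation V := 'rV[R]_n.
Local Notation T := (lebesgue_space R n).
Local Notation mu := (@leb R n).
Variable B : V -> set (set V).
Hypotheses (Bb : is_basis B).
Variable c : R.
Hypothesis c1 : (1 <= c)%R.
Hypothesis reg : forall x Q, B x Q -> exists (a : V) (s : R),
  [/\ (0 < s)%R, Q `<=` cube a s & leb (cube a s) <= c%:E * leb Q].

(** For nonnegative [g], the set where the maximal function exceeds [l], with denominators
    cleared. *)
Definition large_mean (g : V -> \bar R) (l : R) : set V :=
  [set x | exists2 Q, B x Q & l%:E * leb Q < \int[mu]_(y in Q) g y].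

(** The Vitali selection is made among the surrounding cubes. Disjoint cubes contain disjoint basis
    sets, whose total measure is at most [A / l], and each enlarged cube has at most 5^n c times the
    measure of its basis set. *)
Lemma weak_type (g : V -> \bar R) (l A : R) : (0 < l)%R ->
  measurable_fun (setT : set T) (g : T -> \bar R) -> (forall y, 0 <= g y) ->
  \int[mu]_(y in setT) g y <= A%:E ->
  l%:E * leb (large_mean g l) <= (5 ^+ n * c * A)%:E.
Proof.
move=> l0 mg g0 gA.
have k0 := kappa_gt0 Bb.
have c0 : (0 < c)%R by apply: lt_le_trans c1.
pose I := (V * R * set V)%type.
pose D : set I := [set i | [/\ (0 < i.1.2)%R, i.2 `<=` cube i.1.1 i.1.2,
  leb (cube i.1.1 i.1.2) <= c%:E * leb i.2, lmeasurable i.2 &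
  l%:E * leb i.2 < \int[mu]_(y in i.2) g y]].
have sub (o : nat -> option I) : (forall k i, o k = Some i -> D i) ->
    (forall j k i i', (j < k)%N -> o j = Some i -> o k = Some i' ->
       cube i.1.1 i.1.2 `&` cube i'.1.1 i'.1.2 = set0) ->
    \sum_(k <oo) leb (if o k is Some i then i.2 else set0) <= (A / l)%:E.
  move=> oD odisj; pose P k : set T := if o k is Some i then i.2 else set0.
  have mP k : measurable (P k).
    by rewrite /P; case E : (o k) => [i|]; [have [] := oD _ _ E|exact: measurable0].
  have tP : trivIset setT P.
    have tlt j k : (j < k)%N -> P j `&` P k = set0.
      rewrite /P; case E : (o j) => [i|] jk; last by rewrite set0I.
      case E' : (o k) => [i'|]; last by rewrite setI0.
      have [_ Pi _ _ _] := oD _ _ E; have [_ Pi' _ _ _] := oD _ _ E'.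
      apply/seteqP; split => // x [Px Px'].
      by rewrite -(odisj _ _ _ _ jk E E'); split; [exact: Pi|exact: Pi'].
    apply/trivIsetP => j k _ _; rewrite neq_ltn => /orP[|] jk; first exact: tlt.
    by rewrite setIC; exact: tlt.
  rewrite EFinM -lee_pdivrMr ?invr_gt0// invrK muleC -nneseriesZl; last by move=> *; exact: leb_ge0.
  apply: le_trans gA.
  have mU : measurable (\bigcup_k P k) by exact: bigcup_measurable.
  apply: (@le_trans _ _ (\int[mu]_(y in \bigcup_k P k) g y)); last first.
    by apply: ge0_subset_integral.
  rewrite ge0_integral_bigcup//; last first.
    exact: measurable_funS mg.
  apply: lee_nneseries => [k _ _|k _].
    by rewrite mule_ge0 ?leb_ge0// lee_fin ltW.
  rewrite /P; case E : (o k) => [i|]; last by rewrite measure0 mule0 integral_set0.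
  by apply/ltW; have [] := oD _ _ E.
have A0 : (0 <= A)%R.
  by rewrite -lee_fin; apply: le_trans gA; apply: integral_ge0.
have Dk i : D i -> ((i.1.2 ^+ n * kappa R n)%:E <= c%:E * leb i.2).
  move=> [s0 _ ccQ _ _]; apply: le_trans ccQ; rewrite -(leb_hcube i.1.1)//.
  by apply: le_leb => x xa j; have /andP[/ltW -> ->] := xa j.
have DA i : D i -> leb i.2 <= (A / l)%:E.
  move=> [_ _ _ mQ lQ]; rewrite EFinM -lee_pdivrMr ?invr_gt0// invrK muleC.
  apply/ltW/(lt_le_trans lQ)/(le_trans _ gA).
  by apply: ge0_subset_integral.
(* Regularity bounds s^n by c (A / l) / kappa; the added 1 turns this into a bound on s, since s <=
   s^n once 1 <= s. *)
have := @vitali_greedy R n I D (fun i => i.1.1) (fun i => i.1.2) (1 + c * (A / l) / kappa R n)%R.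
case.
- move=> i Di; have [s0 _ _ _ _] := Di; rewrite s0 /=.
  have : (i.1.2 ^+ n <= c * (A / l) / kappa R n)%R.
    rewrite ler_pdivlMr// -lee_fin; apply: (le_trans (Dk i Di)).
    by rewrite EFinM; apply: lee_wpmul2l; [rewrite lee_fin ltW|exact: DA].
  have [s1|s1] := leP 1%R i.1.2.
    by move=> h; rewrite (le_trans (ler_eXnr n0 s1))// (le_trans h)// lerDr.
  move=> h; rewrite (le_trans (ltW s1))// lerDl; apply: le_trans h.
  by rewrite exprn_ge0// ltW.
(* Each of these sets would have measure at least [z], so the total would exceed [A / l]. *)
- move=> eta t eta0 tD tdisj.
  have := sub (Some \o t); rewrite /=; move=> H.
  have {}H : \sum_(k <oo) leb (t k).2 <= (A / l)%:E.
    apply: H => [k i [<-]|j k i i' jk [<-] [<-]]; [by have [] := tD k|exact: tdisj].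
  pose z := (eta ^+ n * kappa R n / c)%R.
  have z0 : (0 < z)%R by rewrite divr_gt0// mulr_gt0// exprn_gt0.
  have zt k : z%:E <= leb (t k).2.
    have [Dtk etk] := tD k; have [s0 _ _ _ _] := Dtk.
    have := Dk _ Dtk; rewrite muleC -lee_pdivrMr//; apply: le_trans.
    rewrite -EFinM lee_fin ler_pM2r ?invr_gt0// ler_pM2r//.
    by apply: lerXn2r; rewrite ?nnegrE // ltW.
  have [N N0 NN] := exists_nat_gt (A / l / z)%R.
  rewrite ltr_pdivrMr// in NN.
  have : (N%:R * z)%:E <= (A / l)%:E.
    apply: le_trans H; apply: le_trans (nneseries_lim_ge N _); last by move=> *; exact: leb_ge0.
    apply: (@le_trans _ _ (\sum_(0 <= k < N) z%:E)); last by apply: lee_sum.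
    by rewrite sumEFin lee_fin sumr_const_nat subn0 mulr_natl.
  by rewrite lee_fin leNgt NN.
move=> o [oD odisj ocov].
rewrite muleC -lee_pdivlMr//.
apply: (@le_trans _ _ (leb (\bigcup_k (if o k is Some j then
    cube (j.1.1 - const_mx (2 * j.1.2))%R (5 * j.1.2)%R else set0)))).
  apply: le_leb => x [Q xQ lQ].
  have [[_ mQ] _ Qx] := basis_prop Bb xQ.
  have [a [s [s0 Qa as_]]] := reg xQ.
  have [|k [j [ok ij]]] := ocov (a, s, Q); first by split.
  by exists k => //; rewrite ok; apply: ij; exact: Qa.
apply: le_trans (lebesgue_outer_sigma_subadditive _) _.
apply: (@le_trans _ _ (\sum_(k <oo) ((5 ^+ n * c)%:E * leb (if o k is Some i then i.2 else set0)))).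
  apply: lee_nneseries => [k _ _|k _]; first exact: leb_ge0.
  case E : (o k) => [i|]; last by rewrite lebesgue_outer0 measure0 mule0.
  have [_ _ ci _ _] := oD _ _ E.
  rewrite cube5E -/(leb _) leb_aff// EFinM -muleA.
  by apply: lee_wpmul2l; [rewrite lee_fin exprn_ge0|exact: ci].
rewrite nneseriesZl; last by move=> *; exact: leb_ge0.
have -> : (5 ^+ n * c * A)%:E * (l^-1)%:E = (5 ^+ n * c)%:E * (A / l)%:E.
  by rewrite -!EFinM mulrA.
apply: lee_wpmul2l; last exact: sub oD odisj.
by rewrite lee_fin mulr_ge0 ?exprn_ge0// ltW.
Qed.

End weak_type.

(** * Linear upper and lower bounds for the halo function *)

Section halo_bounds.
Variables (R : realType) (n : nat).
Hypothesis n0 : (0 < n)%N.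
Local Notation V := 'rV[R]_n.
Local Notation T := (lebesgue_space R n).
Local Notation mu := (@leb R n).
Variable B : V -> set (set V).
Hypotheses (Bb : is_basis B).

Lemma halo_upper : regular_basis B ->
  exists2 c : R, (0 < c)%R & forall t : R, (1 <= t)%R -> halo B t <= (c * t)%:E.
Proof.
move=> [c c1 reg]; have c0 : (0 < c)%R by apply: lt_le_trans c1.
have e5 : (1 <= 5 ^+ n :> R)%R by rewrite exprn_ege1// ler1n.
have c50 : (1 <= 5 ^+ n * c)%R by rewrite -[leLHS]mulr1 ler_pM// ltW.
exists (2 * (5 ^+ n * c))%R; first by rewrite mulr_gt0//; lra.
move=> t t1; rewrite /halo; case: ifPn => [_|].
  by rewrite lee_fin -[leLHS]mulr1 ler_pM//; lra.
rewrite -ltNge => {}t1; apply: ge_ereal_sup => _ [E [[bE mE] E0] <-].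
have Eoo := leb_bounded_lty bE.
have Ef : leb E \is a fin_num by rewrite ge0_fin_numE// ltW.
have t0 : (0 < t)%R by lra.
(* The halo function uses a non-strict inequality at level [t^-1], the weak type bound a strict one;
   half the level reconciles them and costs the factor 2. *)
pose l := (2 * t)^-1%R.
have l0 : (0 < l)%R by rewrite invr_gt0 mulr_gt0.
have := @weak_type R n n0 B Bb c c1 reg (fun y => (\1_E y)%:E) l (fine (leb E)) l0.
rewrite integral_indic// ?setIT// fineK// => H.
have {}H : l%:E * leb (large_mean B (fun y => (\1_E y)%:E) l) <= (5 ^+ n * c * fine (leb E))%:E.
  by apply: H => //; apply/measurable_EFinP; exact: measurable_indic.
have Efine : (0 < fine (leb E))%R by rewrite fine_gt0// E0.
rewrite -(fineK Ef) inver gt_eqF// lee_pdivrMr//.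
apply: (@le_trans _ _ (leb (large_mean B (fun y => (\1_E y)%:E) l))).
  apply: le_leb => x /= tx.
  have : l%:E < maximal_operator B (\1_E) x.
    apply: lt_le_trans tx; rewrite lte_fin /l invfM gtr_pMl ?invr_gt0//; lra.
  move=> /ereal_sup_gt[_ [Q xQ <-]].
  have [[_ mQ] _ _] := basis_prop Bb xQ; have [q q0 Qq] := basis_leb Bb xQ.
  rewrite average_indic// Qq inver gt_eqF// lte_pdivlMr// -Qq => lQ.
  by exists Q => //; rewrite integral_indic.
rewrite muleC -lee_pdivlMr// in H; apply: (le_trans H).
by rewrite /l invrK -!EFinM lee_fin; lra.
Qed.

Hypotheses (Bh : homothecy_invariant B) (Bc : convex_basis B).

Lemma halo_ge (t : R) (E X : set V) (w r : R) : (1 < t)%R -> (0 < r)%R ->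
  bounded_lmeasurable E -> leb E = r%:E -> (w * r)%:E <= leb X ->
  (forall x, X x -> exists Q, B x Q /\ (t^-1)%:E * leb Q <= leb (E `&` Q)) ->
  w%:E <= halo B t.
Proof.
move=> t1 r0 bE Er wX HX; rewrite /halo; case: ifPn => [|_]; first by rewrite leNgt t1.
apply: (@le_trans _ _ (leb [set x | (t^-1)%:E <= maximal_operator B (\1_E) x] / leb E)).
  rewrite Er inver gt_eqF// lee_pdivlMr// -EFinM; apply: (le_trans wX).
  apply: le_leb => x /HX[Q [xQ tQ]] /=.
  have [[_ mQ] _ _] := basis_prop Bb xQ; have [q q0 Qq] := basis_leb Bb xQ.
  apply: ereal_sup_ge; exists (average (fun y => `|\1_E y|)%R Q); first by exists Q.
  rewrite average_indic//; last by case: bE.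
  by rewrite Qq inver gt_eqF// lee_pdivlMr// -Qq.
by apply: ereal_sup_ubound; exists E => //; split => //; rewrite Er lte_fin.
Qed.

(** For large [t] the set is scaled to measure t kappa, so that translates containing the unit cube
    have mean exactly [t^-1]. For [t] below [T0] a constant bound is enough: small sets inside the
    unit cube have mean 1. *)
Lemma halo_lower :
  exists2 c : R, (0 < c)%R & forall t : R, (1 <= t)%R -> (c * t)%:E <= halo B t.
Proof.
have k0 := kappa_gt0 Bb; set k := kappa R n in k0.
have [Q QB] := basis_ex Bb (0 : V).
have [[bQ mQ] Q0 _] := basis_prop Bb QB; have [q q0 Qq] := basis_leb Bb QB.
have [p [rho rho0 pQ]] := convex_interior (Bc QB) Q0 (leb_bounded_lty bQ).
have [r r0 Qr] := bounded_inbox bQ.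
(* [T0] is the value of [t] at which the set [s Q] of measure [t k] has inner
   radius [s * rho = 2], enough for its translates to absorb a unit cube. *)
pose T0 := ((2 / rho) ^+ n * q / k)%R.
have T00 : (0 < T0)%R by rewrite divr_gt0// mulr_gt0// exprn_gt0// divr_gt0.
have h2 : (0 < 2^-1 ^+ n :> R)%R by rewrite exprn_gt0.
have h21 : (2^-1 ^+ n <= 1 :> R)%R by apply: exprn_ile1; lra.
pose c := Num.min 1%R (2^-1 ^+ n / T0)%R.
have cT : (c * T0 <= 2^-1 ^+ n)%R.
  by rewrite -ler_pdivlMr// /c ge_min lexx orbT.
have c0 : (0 < c)%R by rewrite lt_min ltr01 divr_gt0.
exists c => // t; rewrite le_eqVlt => /orP[/eqP <-|t1].
  by rewrite /halo lexx mulr1 lee_fin ge_min lexx.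
have t0 : (0 < t)%R by lra.
pose E : set V := hcube 0 1.
have bE : bounded_lmeasurable E.
  have [r' r'0 er] := hcube_inbox (0 : V) 1%R.
  by split; [exact: inbox_bounded er|exact: lmeasurable_hcube].
have Ek : leb E = k%:E by rewrite leb_hcube// expr1n mul1r.
have BQ (x : V) (s : R) : (0 < s)%R -> B x (aff x s @` Q).
  by move=> s0; have := basis_aff Bh x s0 QB; rewrite {1}/aff scaler0 addr0.
have [s s0 sn] : exists2 s : R, (0 < s)%R & (s ^+ n = t * k / q)%R.
  by apply: nth_root_exists => //; rewrite divr_gt0// mulr_gt0.
have sq : (s ^+ n * q = t * k)%R by rewrite sn divfK// gt_eqF.
have [sr|sr] := leP 2%R (s * rho)%R.
  pose X : set V := hcube (- (s *: p))%R (s * rho - 1)%R.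
  apply: (@halo_ge t E X _ k) => // [|x Xx].
    rewrite leb_hcube; last lra.
    rewrite lee_fin ler_pM2r//; apply: (@le_trans _ _ ((s * rho / 2) ^+ n)%R); last first.
      by apply: lerXn2r; rewrite ?nnegrE; lra.
    rewrite -(ler_pM2r T00) mulrAC.
    have -> : ((s * rho / 2) ^+ n * T0 = t)%R.
      rewrite /T0 mulrA mulrA -exprMn (_ : s * rho / 2 * (2 / rho) = s)%R; last first.
        by field; rewrite gt_eqF.
      by rewrite sq mulfK// gt_eqF.
    rewrite -[leRHS]mul1r ler_pM2r//; exact: le_trans cT h21.
  exists (aff x s @` Q); split; first exact: BQ.
  have EQ : E `<=` aff x s @` Q.
    move=> y Ey; exists (aff (affV x s) s^-1 y); last exact: affVK.
    apply: pQ => i; have := Ey i; have := Xx i.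
    rewrite affE !mxE add0r => /andP[x1 x2] /andP[y1 y2].
    have -> : (- (s^-1 * x ord0 i) + s^-1 * y ord0 i - p ord0 i =
        s^-1 * (y ord0 i - (x ord0 i + s * p ord0 i)))%R.
      by field; rewrite gt_eqF.
    rewrite normrM gtr0_norm ?invr_gt0// ler_pdivrMl// ler_norml.
    by apply/andP; split; lra.
  by rewrite leb_aff// (setIidl EQ) Ek Qq -!EFinM lee_fin sq mulKf// gt_eqF.
have tT : (t < T0)%R.
  rewrite /T0 ltr_pdivlMr// -sq ltr_pM2r// ltr_pXn2r ?nnegrE ?(ltW s0)//.
    by rewrite ltr_pdivlMr.
  by rewrite divr_ge0// ltW.
apply: (@le_trans _ _ (2^-1 ^+ n)%R%:E).
  by rewrite lee_fin; apply: le_trans cT; rewrite ler_pM2l// ltW.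
apply: (@halo_ge t E (hcube 0 2^-1%R) _ k) => // [|x Xx].
  by rewrite leb_hcube//; lra.
(* [e] keeps the set above the lower faces of [E]; the other term of the minimum keeps it below the
   upper faces, as [x] is at most 1/2. *)
have [|e e0 ex] := @finite_min R n (fun i => x ord0 i / r)%R.
  by move=> i; have /andP[xi _] := Xx i; rewrite mxE in xi; rewrite divr_gt0.
have e'0 : (0 < Num.min e (2^-1 / r) / 2)%R.
  by rewrite divr_gt0// lt_min e0 divr_gt0//; lra.
exists (aff x (Num.min e (2^-1 / r) / 2)%R @` Q); split; first exact: BQ.
have QE : aff x (Num.min e (2^-1 / r) / 2)%R @` Q `<=` E.
  move=> _ [y Qy <-] i; rewrite affE mxE add0r.
  have := Xx i; rewrite !mxE add0r => /andP[x1 x2].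
  have y1 := Qr _ Qy i.
  set m := Num.min _ _ in e'0 *.
  have m1 : (m * r <= x ord0 i)%R.
    by rewrite -ler_pdivlMr// (le_trans _ (ex i))// ge_min lexx.
  have m2 : (m * r <= 2^-1)%R by rewrite -ler_pdivlMr// ge_min lexx orbT.
  have my : (`|m / 2 * y ord0 i| <= m / 2 * r)%R.
    by rewrite normrM gtr0_norm// ler_pM2l.
  have mr : (0 < m * r)%R by rewrite mulr_gt0//; lra.
  rewrite ler_norml in my; case/andP: my => ? ?.
  by apply/andP; split; lra.
rewrite (setIidr QE) leb_aff// Qq -!EFinM lee_fin.
rewrite -[leRHS]mul1r; apply: ler_wpM2r; last by rewrite invf_le1// ltW.
by rewrite mulr_ge0 ?exprn_ge0 ?(ltW e'0)// ltW.
Qed.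

End halo_bounds.

(** * Differentiation by regular bases *)

Lemma cvg0_ex_lt (R : realType) (u : nat -> \bar R) (d : R) :
  u k @[k --> \oo] --> 0 -> (0 < d)%R -> exists k, u k < d%:E.
Proof.
move=> /fine_cvgP[fu cu] d0.
have : \forall k \near \oo, (fine (u k) < d)%R by exact: cvgr_lt cu _ d0.
move=> /(filterI fu)[k _ /(_ k (leqnn k))[/= fk uk]].
by exists k; rewrite -(fineK fk) lte_fin.
Qed.

Section differentiation.
Variables (R : realType) (n : nat).
Hypothesis n0 : (0 < n)%N.
Local Notation V := 'rV[R]_n.
Local Notation T := (lebesgue_space R n).
Local Notation mu := (@leb R n).
Variable B : V -> set (set V).
Hypotheses (Bb : is_basis B).
Implicit Types (f g : V -> R) (x : V) (e l : R).

(** The epsilon form of differentiability, for one [e]; unlike the two derivatives it passes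
    directly to sums and multiples. *)
Definition close_means f l e x : Prop := exists2 d : R, (0 < d)%R &
  forall Q, B x Q -> eucl_diam Q < d%:E -> (l - e)%:E <= average f Q <= (l + e)%:E.

Lemma basis_small_set x (d : R) : (0 < d)%R -> exists2 Q, B x Q & eucl_diam Q < d%:E.
Proof.
move=> d0; have [_ [Q_ [QB Qd]]] := Bb x.
by have [k kd] := cvg0_ex_lt Qd d0; exists (Q_ k).
Qed.

Lemma lower_le_upper f x : lower_derivative B f x <= upper_derivative B f x.
Proof.
apply: ge_ereal_sup => _ [d1 /= d10 <-]; apply: le_ereal_inf_tmp => _ [d2 /= d20 <-].
have [|Q xQ Qd] := @basis_small_set x (Num.min d1 d2); first by rewrite lt_min d10.
apply: (@le_trans _ _ (average f Q)).
  apply: ereal_inf_lbound; exists Q => //; split => //; apply: (lt_le_trans Qd).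
  by rewrite lee_fin ge_min lexx.
apply: ereal_sup_ubound; exists Q => //; split => //; apply: (lt_le_trans Qd).
by rewrite lee_fin ge_min lexx orbT.
Qed.

Lemma derivativesP f x l :
  (upper_derivative B f x = l%:E /\ lower_derivative B f x = l%:E) <->
  (forall e, (0 < e)%R -> close_means f l e x).
Proof.
split => [[up lo] e e0|H].
  have /ereal_inf_lt[_ [d1 /= d10 <-] d1l] : upper_derivative B f x < (l + e)%:E.
    by rewrite up lte_fin ltrDl.
  have /ereal_sup_gt[_ [d2 /= d20 <-] d2l] : (l - e)%:E < lower_derivative B f x.
    by rewrite lo lte_fin ltrBlDr ltrDl.
  exists (Num.min d1 d2) => [|Q xQ Qd]; first by rewrite lt_min d10.
  apply/andP; split.
    apply: (le_trans (ltW d2l)); apply: ereal_inf_lbound; exists Q => //; split => //.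
    by apply: (lt_le_trans Qd); rewrite lee_fin ge_min lexx orbT.
  apply: le_trans (ltW d1l); apply: ereal_sup_ubound; exists Q => //; split => //.
  by apply: (lt_le_trans Qd); rewrite lee_fin ge_min lexx.
have up : upper_derivative B f x <= l%:E.
  apply/lee_addgt0Pr => e e0; have [d d0 dH] := H e e0.
  apply: (@le_trans _ _ (ereal_sup [set average f Q | Q in [set Q | B x Q /\ eucl_diam Q < d%:E]])).
    by apply: ereal_inf_lbound; exists d.
  by apply: ge_ereal_sup => _ [Q [xQ Qd] <-]; rewrite -EFinD; have /andP[] := dH Q xQ Qd.
have lo : l%:E <= lower_derivative B f x.
  apply/lee_addgt0Pr => e e0; have [d d0 dH] := H e e0.
  rewrite -leeBlDr// -EFinB.
  apply: (@le_trans _ _ (ereal_inf [set average f Q | Q in [set Q | B x Q /\ eucl_diam Q < d%:E]])); last first.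
    by apply: ereal_sup_ubound; exists d.
  by apply: le_ereal_inf_tmp => _ [Q [xQ Qd] <-]; have /andP[] := dH Q xQ Qd.
have lu := lower_le_upper f x; split; apply/eqP; rewrite eq_le.
  by rewrite up (le_trans lo).
by rewrite lo (le_trans lu).
Qed.

Lemma average_fin_num f x Q : lebesgue_integrable f -> B x Q -> average f Q \is a fin_num.
Proof.
move=> fi xQ; have [[_ mQ] _ _] := basis_prop Bb xQ; have [q q0 Qq] := basis_leb Bb xQ.
rewrite /average Qq inver gt_eqF// fin_numM//; apply: integrable_fin_num => //.
exact: integrableS fi.
Qed.

Lemma averageD f g x Q : lebesgue_integrable f -> lebesgue_integrable g -> B x Q ->
  average (fun y => f y + g y)%R Q = average f Q + average g Q.
Proof.
move=> fi gi xQ; have [[_ mQ] _ _] := basis_prop Bb xQ; have [q q0 Qq] := basis_leb Bb xQ.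
have fiQ : mu.-integrable Q (fun y => (f y)%:E) by exact: integrableS fi.
have giQ : mu.-integrable Q (fun y => (g y)%:E) by exact: integrableS gi.
rewrite /average Qq inver gt_eqF// -muleDl//; last first.
  by apply: fin_num_adde_defl; apply: integrable_fin_num.
by congr (_ * _); rewrite -integralD.
Qed.

Lemma averageZ f x Q (a : R) : lebesgue_integrable f -> B x Q ->
  average (fun y => a * f y)%R Q = a%:E * average f Q.
Proof.
move=> fi xQ; have [[_ mQ] _ _] := basis_prop Bb xQ.
have fiQ : mu.-integrable Q (fun y => (f y)%:E) by exact: integrableS fi.
by rewrite /average muleA; congr (_ * _); rewrite -integralZl.
Qed.

Lemma integrable_add f g : lebesgue_integrable f -> lebesgue_integrable g ->
  lebesgue_integrable (fun y => f y + g y)%R.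
Proof. by move=> fi gi; exact: (@integrableD _ T R mu setT measurableT _ _ fi gi). Qed.

Lemma integrable_scale f (a : R) : lebesgue_integrable f ->
  lebesgue_integrable (fun y => a * f y)%R.
Proof. by move=> fi; exact: (@integrableZl _ T R mu setT measurableT a _ fi). Qed.

Lemma close_meansD f g x l m e : lebesgue_integrable f -> lebesgue_integrable g ->
  close_means f l (e / 2) x -> close_means g m (e / 2) x ->
  close_means (fun y => f y + g y)%R (l + m) e x.
Proof.
move=> fi gi [d1 d10 H1] [d2 d20 H2].
exists (Num.min d1 d2) => [|Q xQ Qd]; first by rewrite lt_min d10.
have /(H1 Q xQ) h1 : eucl_diam Q < d1%:E.
  by apply: (lt_le_trans Qd); rewrite lee_fin ge_min lexx.
have /(H2 Q xQ) h2 : eucl_diam Q < d2%:E.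
  by apply: (lt_le_trans Qd); rewrite lee_fin ge_min lexx orbT.
rewrite (averageD fi gi xQ); move: h1 h2.
rewrite -(fineK (average_fin_num fi xQ)) -(fineK (average_fin_num gi xQ)).
rewrite -EFinD !lee_fin => /andP[? ?] /andP[? ?]; apply/andP; split; lra.
Qed.

Lemma close_meansZ f x l e (a : R) : lebesgue_integrable f ->
  close_means f l (e / (`|a| + 1)) x -> (0 < e)%R ->
  close_means (fun y => a * f y)%R (a * l) e x.
Proof.
move=> fi [d d0 H] e0; exists d => // Q xQ Qd; have := H Q xQ Qd.
rewrite (averageZ a fi xQ) -(fineK (average_fin_num fi xQ)) -EFinM !lee_fin.
move: (fine _) => v /andP[v1 v2].
have a1 : (0 < `|a| + 1)%R by rewrite ltr_pwDr.
have vl : (`|v - l| <= e / (`|a| + 1))%R by rewrite ler_norml; apply/andP; split; lra.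
have : (`|a * (v - l)| <= e)%R.
  rewrite normrM; apply: (@le_trans _ _ ((`|a| + 1) * (e / (`|a| + 1)))%R).
    by apply: ler_pM => //; rewrite lerDl.
  by rewrite mulrC divfK// gt_eqF.
by rewrite ler_norml => /andP[? ?]; apply/andP; split; lra.
Qed.

Definition differentiated f := lebesgue_integrable f /\ differentiates B f.

Lemma differentiatedP f : differentiated f <-> lebesgue_integrable f /\
  mu.-negligible [set x : T | ~ forall e, (0 < e)%R -> close_means f (f x) e x].
Proof.
split => -[fi H]; split => //; apply: negligibleS H => x nx H; apply: nx.
  exact: (derivativesP f x (f x)).1.
exact: (derivativesP f x (f x)).2.
Qed.

Lemma differentiatedD f g : differentiated f -> differentiated g -> differentiated (fun y => f y + g y)%R.
Proof.
move=> /differentiatedP[fi fd] /differentiatedP[gi gd]; apply/differentiatedP; split; first exact: integrable_add.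
apply: negligibleS (negligibleU fd gd) => x nx.
apply: contrapT => /not_orP[/contrapT fx /contrapT gx]; apply: nx => e e0.
by apply: close_meansD => //; [apply: fx|apply: gx]; rewrite divr_gt0.
Qed.

Lemma differentiatedZ f (a : R) : differentiated f -> differentiated (fun y => a * f y)%R.
Proof.
move=> /differentiatedP[fi fd]; apply/differentiatedP; split; first exact: integrable_scale.
apply: negligibleS fd => x nx fx; apply: nx => e e0.
by apply: close_meansZ => //; apply: fx; rewrite divr_gt0// ltr_pwDr.
Qed.

(** Null sets of an outer measure satisfy the splitting condition, so nothing need be known about
    the measurability of exceptional sets. *)
Lemma leb_eq0_negligible (X : set V) : leb X = 0 -> mu.-negligible (X : set T).
Proof.
move=> X0; exists X; split => //.
apply: (@le_caratheodory_measurable R V (@lebesgue_outer R n)) => Y.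
have YX : leb (Y `&` X) <= 0 by rewrite -X0; apply: le_leb => y [].
have YC : leb (Y `&` ~` X) <= leb Y by apply: le_leb => y [].
by have := leeD YX YC; rewrite add0e.
Qed.

(** * Closure in mean, and the passage from bounded sets to integrable functions *)

Section closure.
Variable c : R.
Hypothesis c1 : (1 <= c)%R.
Hypothesis reg : forall x Q, B x Q -> exists (a : V) (s : R),
  [/\ (0 < s)%R, Q `<=` cube a s & leb (cube a s) <= c%:E * leb Q].

(** Write f = g + (f - g). The means of [f] stay within 3 e of [f x] unless [x] is exceptional for
    [g], some mean of |f - g| exceeds e (weak type inequality), or |f - g| is at least e at [x]
    (Chebyshev). *)
Lemma differentiated_closed f : lebesgue_integrable f ->
  (forall eta : R, (0 < eta)%R -> exists2 g, differentiated g &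
     \int[mu]_(y in setT) `|(f y - g y)%:E| <= eta%:E) ->
  differentiated f.
Proof.
move=> fi approx; apply/differentiatedP; split => //.
pose bad (e : R) := [set x | ~ close_means f (f x) (3 * e) x].
have c0 : (0 < c)%R by apply: lt_le_trans c1.
have C0 : (0 < 5 ^+ n * c + 1)%R by rewrite ltr_pwDr// mulr_ge0 ?exprn_ge0// ltW.
have bad0 e : (0 < e)%R -> leb (bad e) = 0.
  move=> e0; apply/eqP; rewrite eq_le leb_ge0 andbT.
  apply/lee_addgt0Pr => eps eps0; rewrite add0e.
  (* The two estimates add up to (5^n c + 1) eta / e, which is [eps]. *)
  pose eta := (eps * e / (5 ^+ n * c + 1))%R.
  have eta0 : (0 < eta)%R by rewrite divr_gt0// mulr_gt0.
  have [g ng Afg] := approx eta eta0.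
  have /differentiatedP[gi [N [mN N0 gN]]] := ng.
  have hi : lebesgue_integrable (fun y => f y - g y)%R.
    by exact: (@integrableB _ T R mu setT measurableT _ _ fi gi).
  pose h (y : V) : \bar R := `|(f y - g y)%:E|.
  have mh : measurable_fun (setT : set T) (h : T -> \bar R).
    exact: measurableT_comp (measurable_int mu hi).
  have h0 y : 0 <= h y by exact: abse_ge0.
  have W := weak_type n0 Bb c1 reg e0 mh h0 Afg.
  pose M := [set x : V | e%:E <= h x].
  have HM : e%:E * leb M <= eta%:E.
    apply: le_trans Afg; have := @le_integral_abse _ T R mu setT measurableT _ e (measurable_int mu hi) e0.
    by rewrite setTI.
  apply: (@le_trans _ _ (leb (N `|` (large_mean B h e `|` M)))).
    apply: le_leb => x bx; apply: contrapT => /not_orP[Nx /not_orP[Lx Mx]].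
    apply: bx; have gx : close_means g (g x) e x.
      by apply: contrapT => ngx; apply: Nx; apply: gN => /(_ e e0).
    have [d d0 H] := gx; exists d => // Q xQ Qd.
    have [[_ mQ] _ _] := basis_prop Bb xQ; have [q q0 Qq] := basis_leb Bb xQ.
    have := H Q xQ Qd.
    have -> : average f Q = average g Q + average (fun y => f y - g y)%R Q.
      by rewrite -(averageD gi hi xQ); congr (average _ Q); apply/funext => y; rewrite addrC subrK.
    have hQ : `|average (fun y => f y - g y)%R Q| <= e%:E.
      have qa : `|(q^-1)%:E| = (q^-1)%:E by rewrite gee0_abs// lee_fin invr_ge0 ltW.
      rewrite /average abseM Qq inver gt_eqF// qa.
      rewrite lee_pdivrMr// -Qq.
      apply: (@le_trans _ _ (\int[mu]_(y in Q) h y)).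
        by apply: le_abse_integral => //; apply: measurable_int; exact: integrableS hi.
      by rewrite leNgt; apply/negP => lQ; apply: Lx; exists Q.
    have fgx : (`|f x - g x| < e)%R.
      by move/negP: Mx; rewrite /M /= /h -ltNge lte_fin.
    move: hQ; rewrite -(fineK (average_fin_num gi xQ)) -(fineK (average_fin_num hi xQ)).
    rewrite -EFinD !lee_fin ler_norml => /andP[? ?] /andP[? ?].
    move: fgx; rewrite ltr_norml => /andP[? ?]; apply/andP; split; lra.
  apply: le_trans (lebU _ _) _; rewrite [leb N]N0 add0e; apply: le_trans (lebU _ _) _.
  rewrite -(mul1e eps%:E) -(lee_pmul2l (x := e%:E)) ?lte_fin//.
  rewrite ge0_muleDr ?leb_ge0//; apply: (le_trans (leeD W HM)).
  rewrite -EFinD mul1e -EFinM lee_fin -[X in (_ + X <= _)%R]mul1r -mulrDl /eta.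
  by rewrite mulrC divfK ?gt_eqF// mulrC.
have : mu.-negligible (\bigcup_k (bad (k.+1%:R^-1)%R) : set T).
  apply: negligible_bigcup => k; apply: leb_eq0_negligible; apply: bad0.
  by rewrite invr_gt0.
apply: negligibleS => x /= nx; apply: contrapT => nbx; apply: nx => e e0.
have [k k0 ke] := exists_nat_gt (3 / e)%R.
have : close_means f (f x) (3 * k.+1%:R^-1)%R x.
  by apply: contrapT => nc; apply: nbx; exists k.
move=> [d d0 H]; exists d => // Q xQ Qd; have /andP[h1 h2] := H Q xQ Qd.
have k3 : (3 * k.+1%:R^-1 <= e)%R.
  rewrite ler_pdivrMr// -ler_pdivrMl// mulrC; apply/ltW/(lt_trans ke).
  by rewrite ltr_nat.
move: (3 * _)%R k3 h1 h2 => v ve h1 h2.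
by apply/andP; split; [apply: le_trans h1|apply: (le_trans h2)]; rewrite lee_fin; lra.
Qed.

Hypothesis Bd : density_basis B.

Lemma integrable_indic_lty (F : set V) : lmeasurable F -> leb F < +oo ->
  lebesgue_integrable (\1_F).
Proof.
move=> mF Foo; apply/integrableP; split.
  by apply/measurable_EFinP; exact: measurable_indic.
under eq_integral => x _ do rewrite gee0_abs ?lee_fin//.
by rewrite integral_indic// setIT.
Qed.

(** A density basis handles bounded sets only: [F] is truncated by growing cubes, and the measure of
    the remainder tends to 0. *)
Lemma differentiated_indic (F : set V) : lmeasurable F -> leb F < +oo -> differentiated (\1_F).
Proof.
move=> mF Foo; pose H k : set V := hcube (const_mx (- k.+1%:R))%R (2 * k.+1%:R)%R.
have mH k : lmeasurable (H k) by exact: lmeasurable_hcube.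
have mFH k : measurable (F `\` H k : set T) by apply: (@measurableD _ T); [exact: mF|exact: mH].
have cF : mu (F `\` H k) @[k --> \oo] --> mu (\bigcap_k (F `\` H k)).
  apply: (@nonincreasing_cvg_mu _ T R mu (fun k => F `\` H k)) => //.
  - by apply: le_lt_trans Foo; apply: le_leb => x [].
  - exact: bigcap_measurable.
  - move=> i j ij; apply/subsetPset => x [Fx nHx]; split => // Hx; apply: nHx => l.
    have := Hx l; rewrite !mxE => /andP[? ?].
    have : (i.+1%:R <= j.+1%:R :> R)%R by rewrite ler_nat.
    by move=> ?; apply/andP; split; lra.
have F0 : \bigcap_k (F `\` H k) = set0.
  apply/seteqP; split => // x Fx.
  have [k _ kx] := exists_nat_gt (`|x|)%R.
  have [_ nH] := Fx k I; apply: nH => l; have := ler_coord x l.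
  have : (k%:R <= k.+1%:R :> R)%R by rewrite ler_nat.
  rewrite !mxE ler_norml => ? /andP[? ?]; apply/andP; split; lra.
rewrite F0 measure0 in cF.
apply: differentiated_closed => [|eta eta0]; first exact: integrable_indic_lty.
have [k ke] := cvg0_ex_lt cF eta0.
have mFk : lmeasurable (F `&` H k) by apply: (@measurableI _ T); [exact: mF|exact: mH].
exists (\1_(F `&` H k)).
  split; first by apply: integrable_indic_lty => //; apply: le_lt_trans Foo; apply: le_leb => x [].
  apply: Bd; split => //; have [r r0 Hr] := @hcube_inbox R n (const_mx (- k.+1%:R))%R (2 * k.+1%:R)%R.
  by apply: (@inbox_bounded _ _ r) => x [_ /Hr].
have -> : \int[mu]_(y in setT) `|(\1_F y - \1_(F `&` H k) y)%:E| =
    \int[mu]_(y in setT) (\1_(F `\` H k) y)%:E.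
  apply: eq_integral => y _; rewrite !indicE in_setD in_setI.
  by case: (y \in F); case: (y \in H k); rewrite /= ?subrr ?subr0 ?normr0 ?normr1.
by rewrite integral_indic// setIT ltW.
Qed.

Lemma differentiated0 : differentiated (fun=> 0%R).
Proof.
have := differentiatedZ 0%R (@differentiated_indic set0 _ _).
rewrite (_ : (fun y => 0 * \1_set0 y)%R = (fun=> 0%R)); last first.
  by apply/funext => y; rewrite mul0r.
apply; first exact: (@measurable0 _ T).
by rewrite measure0.
Qed.

Lemma differentiated_sfun (g : {sfun T >-> R}) : @lebesgue_integrable R n (g : T -> R) -> differentiated (g : T -> R).
Proof.
move=> gi; rewrite (_ : (g : T -> R) =
  (fun x => \sum_(y <- finmap.enum_fset (fset_set (range g))) y * \1_(g @^-1` [set y]) x)%R); last first.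
  by apply/funext => x; rewrite fimfunE fsbig_finite.
elim: (finmap.enum_fset _) => [|y s IH].
  rewrite (_ : (fun x => _) = (fun=> 0%R)); first exact: differentiated0.
  by apply/funext => x; rewrite big_nil.
rewrite (_ : (fun x => _) = (fun x => y * \1_(g @^-1` [set y]) x +
    \sum_(y <- s) y * \1_(g @^-1` [set y]) x)%R); last first.
  by apply/funext => x; rewrite big_cons.
apply: differentiatedD => //.
(* The level set of 0 may have infinite measure; those of the other values are finite by
   Chebyshev. *)
have [->|y0] := eqVneq y 0%R.
  rewrite (_ : (fun x => _) = (fun=> 0%R)); first exact: differentiated0.
  by apply/funext => x; rewrite mul0r.
have my : lmeasurable (g @^-1` [set y]) by exact: measurable_sfunP.
apply: differentiatedZ; apply: differentiated_indic => //.
have y00 : (0 < `|y|)%R by rewrite normr_gt0.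
have /integrableP[mg goo] := gi.
have := @le_integral_abse _ T R mu setT measurableT _ `|y|%R mg y00.
rewrite setTI => H.
have {}H : `|y|%:E * leb (g @^-1` [set y]) < +oo.
  apply: le_lt_trans goo; apply: le_trans H; apply: lee_wpmul2l; first by rewrite lee_fin.
  by apply: le_leb => x /= ->.
rewrite ltey; apply/eqP => E; move: H; rewrite E muleC mulyr gtr0_sg// mul1e ltxx//.
Qed.

Lemma differentiated_integrable f : lebesgue_integrable f -> differentiated f.
Proof.
move=> fi; apply: differentiated_closed => // eta eta0.
have [g [gi _ gf]] := approximation_sfun_integrable measurableT fi.
have [k kE] := cvg0_ex_lt gf eta0.
exists (g k); first by apply: differentiated_sfun; exact: gi.
exact: ltW.
Qed.

End closure.

Lemma regular_differentiates : density_basis B -> regular_basis B ->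
  differentiates_class B (@lebesgue_integrable R n).
Proof. by move=> Bd [c c1 reg] f /(differentiated_integrable c1 reg Bd)[]. Qed.

End differentiation.

Theorem mainTheorem5 (R : realType) (n : nat) (hn : (2 <= n)%N)
    (B : 'rV[R]_n -> set (set 'rV[R]_n))
    (B_basis : is_basis B)
    (B_homothecy : homothecy_invariant B)
    (B_convex : convex_basis B)
    (B_density : density_basis B) :
  (differentiates_class B (@lebesgue_integrable R n) <-> regular_basis B) /\
  (regular_basis B <->
    exists c1 c2 : R, [/\ (0 < c1)%R, (0 < c2)%R &
      forall t : R, (1 <= t)%R ->
        ((c1 * t)%:E <= halo B t)%E /\ (halo B t <= (c2 * t)%:E)%E]).
Proof.
have n0 : (0 < n)%N := ltnW hn.
have to_diff := regular_differentiates n0 B_basis B_density.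
split; split => //.
- exact: differentiates_regular.
- move=> reg; have [c1 c10 h1] := halo_lower n0 B_basis B_homothecy B_convex.
  have [c2 c20 h2] := halo_upper n0 B_basis reg.
  by exists c1, c2; split => // t t1; split; [exact: h1|exact: h2].
- move=> [c1 [c2 [_ _ h]]]; apply: (@halo_linear_regular R n n0 B B_basis B_homothecy B_convex c2) => t t1.
  by have [] := h t t1.
Qed.
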